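(* Let $k$ be a field. (a) There is an exact category structure on the additive category $\mathsf{Top}^{\mathsf{sc}}_{\mathbb Z}$, called the strong exact structure, in which a short sequence $0\to\mathfrak K\to\mathfrak A\to\mathfrak C\to0$ is exact if and only if it satisfies Ex1 and the induced map $\mathfrak A[[X]]\to\mathfrak C[[X]]$ is surjective for every set $X$. The admissible monomorphisms in this exact structure are the strongly closed injective maps, and the admissible epimorphisms are the open strongly surjective maps. The strong exact structure on $\mathsf{Top}^{\mathsf{sc}}_{\mathbb Z}$ is different from (i.e., has fewer short exact sequences than) the maximal exact structure. (b) There is an exact category structure on the additive category $\mathsf{Top}^{\mathsf{sc}}_k$, called the strong exact structure, in which a short sequence $0\to\mathfrak K\to\mathfrak V\to\mathfrak C\to0$ is exact if and only if it satisfies Ex1 and the induced map $\mathfrak V[[X]]\to\mathfrak C[[X]]$ is surjective for every set $X$. The admissible monomorphisms in this exact structure are the strongly closed injective maps, and the admissible epimorphisms are the open strongly surjective maps. The strong exact structure on $\mathsf{Top}^{\mathsf{sc}}_k$ is different from (i.e., has fewer short exact sequences than) the maximal exact structure.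
   Context: All topological abelian groups have linear topology: open subgroups form a base of neighborhoods of zero. All topological $k$-vector spaces ($k$ a fixed field with the discrete topology) have linear topology: open vector subspaces form a base of neighborhoods of zero. The completion of $A$ is $A^{\wedge}=\varprojlim_{U\subset A}A/U$ over the open subgroups (resp. subspaces) $U$, topologized so that the kernels of the projections $A^{\wedge}\to A/U$ form a base of neighborhoods of zero. $A$ is separated (resp. complete) if $A\to A^{\wedge}$ is injective (resp. surjective). $\mathsf{Top}^{\mathsf{sc}}_{\mathbb Z}$ (resp. $\mathsf{Top}^{\mathsf{sc}}_k$) is the additive category of complete, separated topological abelian groups (resp. $k$-vector spaces) and continuous homomorphisms (resp. continuous $k$-linear maps). For $\mathfrak A$ in $\mathsf{Top}^{\mathsf{sc}}_{\mathbb Z}$ or $\mathsf{Top}^{\mathsf{sc}}_k$ and a set $X$, put $\mathfrak A[[X]]=\varprojlim_{\mathfrak U\subset\mathfrak A}(\mathfrak A/\mathfrak U)[X]$, where $\mathfrak U$ ranges over the open subgroups (resp. subspaces) and $B[X]=B^{(X)}$ is the direct sum of $X$ copies of $B$; equivalently, $\mathfrak A[[X]]$ is the group of infinite formal linear combinations $\sum_{x\in X}a_xx$ with families $(a_x\in\mathfrak A)_{x\in X}$ converging to zero (for each open $\mathfrak U$, the set $\{x:a_x\notin\mathfrak U\}$ is finite). A morphism $g\colon\mathfrak A\to\mathfrak B$ induces $g[[X]]\colon\sum a_xx\mapsto\sum g(a_x)x$. A morphism $p\colon\mathfrak A\to\mathfrak C$ is strongly surjective if $p[[X]]\colon\mathfrak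 A[[X]]\to\mathfrak C[[X]]$ is surjective for every set $X$. An injective closed morphism $i\colon\mathfrak K\to\mathfrak A$ is strongly closed if the quotient $\mathfrak A/i(\mathfrak K)$ is complete in the quotient topology and the quotient map $\mathfrak A\to\mathfrak A/i(\mathfrak K)$ is strongly surjective. A short sequence $0\to A'\overset{i}\to A\overset{p}\to A''\to0$ in an additive category satisfies Ex1 if $i$ is a kernel of $p$ and $p$ is a cokernel of $i$. ''Exact category structure'' is in the sense of Quillen; the admissible monomorphisms (epimorphisms) are the morphisms $i$ (resp. $p$) occurring in short exact sequences. The maximal exact structure on an additive category is its largest exact category structure (containing every other one); it exists for $\mathsf{Top}^{\mathsf{sc}}_{\mathbb Z}$ and $\mathsf{Top}^{\mathsf{sc}}_k$, and its short exact sequences are the sequences satisfying Ex1 in which $p$ is a surjective open map. *)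

(* Defs.v *)
From HB Require Import structures.
From mathcomp Require Import all_boot all_algebra generic_quotient ring_quotient.
From mathcomp Require Import boolp classical_sets functions cardinality.
From mathcomp Require Import topology pseudometric_normed_Zmodule tvs.

Set Implicit Arguments.
Unset Strict Implicit.
Unset Printing Implicit Defensive.

Import GRing.Theory.
Local Open Scope classical_set_scope.
Local Open Scope ring_scope.
Local Open Scope quotient_scope.

Record preadditive := Preadditive {
  obj :> Type;
  hom : obj -> obj -> zmodType;
  idm : forall A, hom A A;
  comp : forall A B C, hom B C -> hom A B -> hom A C;
  compA : forall A B C D (h : hom C D) (g : hom B C) (f : hom A B),
    comp h (comp g f) = comp (comp h g) f;
  comp1m : forall A B (f : hom A B), comp (idm B) f = f;
  compm1 : forall A B (f : hom A B), comp f (idm A) = f;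
  compDl : forall A B C (g g' : hom B C) (f : hom A B),
    comp (g + g') f = comp g f + comp g' f;
  compDr : forall A B C (g : hom B C) (f f' : hom A B),
    comp g (f + f') = comp g f + comp g f' }.

Arguments idm {p} A.
Arguments comp {p A B C} g f.
Notation "g \oc f" := (comp g f) (at level 40, left associativity).

Section Exact.
Variable C : preadditive.
Implicit Types A B K L P S T Z : C.

Definition is_zero_object Z : Prop :=
  forall A, (exists! f : hom Z A, True) /\ (exists! f : hom A Z, True).

Definition is_biproduct A B S (iA : hom A S) (iB : hom B S)
    (pA : hom S A) (pB : hom S B) : Prop :=
  [/\ pA \oc iA = idm A, pB \oc iB = idm B, pA \oc iB = 0, pB \oc iA = 0
    & iA \oc pA + iB \oc pB = idm S].

Definition is_additive : Prop :=
  (exists Z, is_zero_object Z) /\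
  (forall A B, exists S (iA : hom A S) (iB : hom B S) (pA : hom S A)
     (pB : hom S B), is_biproduct iA iB pA pB).

Definition is_iso A B (f : hom A B) : Prop :=
  exists g : hom B A, g \oc f = idm A /\ f \oc g = idm B.

Definition is_kernel K A B (i : hom K A) (p : hom A B) : Prop :=
  p \oc i = 0 /\
  forall T (t : hom T A), p \oc t = 0 -> exists! u : hom T K, i \oc u = t.

Definition is_cokernel K A B (p : hom A B) (i : hom K A) : Prop :=
  p \oc i = 0 /\
  forall T (t : hom A T), t \oc i = 0 -> exists! u : hom B T, u \oc p = t.

Definition Ex1 K A B (i : hom K A) (p : hom A B) : Prop :=
  is_kernel i p /\ is_cokernel p i.

Definition is_pushout K A L P (i : hom K A) (f : hom K L)
    (i' : hom L P) (f' : hom A P) : Prop :=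
  f' \oc i = i' \oc f /\
  forall T (a : hom A T) (l : hom L T), a \oc i = l \oc f ->
    exists! u : hom P T, u \oc f' = a /\ u \oc i' = l.

Definition is_pullback A B L P (p : hom A B) (f : hom L B)
    (p' : hom P L) (f' : hom P A) : Prop :=
  p \oc f' = f \oc p' /\
  forall T (a : hom T A) (l : hom T L), p \oc a = f \oc l ->
    exists! u : hom T P, f' \oc u = a /\ p' \oc u = l.

(* A class of short sequences 0 -> K -> A -> B -> 0. *)
Definition seq_class := forall K A B, hom K A -> hom A B -> Prop.

Definition admissible_mono (E : seq_class) K A (i : hom K A) : Prop :=
  exists B (p : hom A B), E K A B i p.

Definition admissible_epi (E : seq_class) A B (p : hom A B) : Prop :=
  exists K (i : hom K A), E K A B i p.

(* Quillen's axioms in Buehler's form: an isomorphism-closed class of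
   kernel-cokernel pairs with [E0], [E1], [E2] and their duals. *)
Record is_exact_structure (E : seq_class) : Prop := {
  exact_additive : is_additive;
  exact_Ex1 : forall K A B (i : hom K A) (p : hom A B),
    E K A B i p -> Ex1 i p;
  exact_iso : forall K A B K' A' B' (i : hom K A) (p : hom A B)
      (i' : hom K' A') (p' : hom A' B')
      (a : hom K K') (b : hom A A') (c : hom B B'),
    is_iso a -> is_iso b -> is_iso c ->
    b \oc i = i' \oc a -> c \oc p = p' \oc b ->
    E K A B i p -> E K' A' B' i' p';
  exact_id_mono : forall A, admissible_mono E (idm A);
  exact_id_epi : forall A, admissible_epi E (idm A);
  exact_comp_mono : forall A B D (g : hom B D) (f : hom A B),
    admissible_mono E g -> admissible_mono E f -> admissible_mono E (g \oc f);
  exact_comp_epi : forall A B D (g : hom B D) (f : hom A B),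
    admissible_epi E g -> admissible_epi E f -> admissible_epi E (g \oc f);
  exact_pushout : forall K A L (i : hom K A) (f : hom K L),
    admissible_mono E i ->
    exists P (i' : hom L P) (f' : hom A P),
      is_pushout i f i' f' /\ admissible_mono E i';
  exact_pullback : forall A B L (p : hom A B) (f : hom L B),
    admissible_epi E p ->
    exists P (p' : hom P L) (f' : hom P A),
      is_pullback p f p' f' /\ admissible_epi E p' }.

Definition seq_sub (E E' : seq_class) : Prop :=
  forall K A B (i : hom K A) (p : hom A B), E K A B i p -> E' K A B i p.

Definition seq_proper (E E' : seq_class) : Prop :=
  seq_sub E E' /\
  exists K A B (i : hom K A) (p : hom A B), E' K A B i p /\ ~ E K A B i p.

Definition is_maximal_exact_structure (E : seq_class) : Prop :=
  is_exact_structure E /\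
  forall E', is_exact_structure E' -> seq_sub E' E.

End Exact.

(* The family [O] below is the set of open subgroups of a topological abelian
   group, or the set of open subspaces of a topological vector space. *)
Section LinearTopology.
Variables (A : PreTopologicalZmodule.type) (O : set (set A)).

Definition linear_topology : Prop :=
  forall N : set A, nbhs 0 N -> exists2 U, O U & U `<=` N.

Definition coset (U : set A) (a : A) : set A := [set a + u | u in U].

(* A point of the projective limit of the A / U, where A / U is the set of
   cosets of U; the transition map A / U -> A / V sends each coset of U to the
   coset of V containing it. *)
Record completion := Completion {
  component : {U : set A | O U} -> set A;
  component_coset : forall U, exists a, component U = coset (sval U) a;
  component_compat : forall U V,
    sval U `<=` sval V -> component U `<=` component V }.

Lemma to_completion_coset (a : A) (U : {U : set A | O U}) :
  exists b, coset (sval U) a = coset (sval U) b.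
Proof. by exists a. Qed.

Lemma to_completion_compat (a : A) (U V : {U : set A | O U}) :
  sval U `<=` sval V -> coset (sval U) a `<=` coset (sval V) a.
Proof. exact: image_subset. Qed.

Definition to_completion (a : A) : completion :=
  Completion (to_completion_coset a) (@to_completion_compat a).

Definition separated : Prop := injective to_completion.

Definition complete : Prop := forall c, exists a, to_completion a = c.

(* A[[X]], as the set of zero-convergent families of coefficients *)
Definition zero_convergent (X : Type) : set (X -> A) :=
  [set a | forall U, O U -> finite_set [set x | ~ U (a x)]].

End LinearTopology.

(* p[[X]] is (a_x)_x |-> (p(a_x))_x *)
Definition strongly_surjective_for (A B : PreTopologicalZmodule.type)
    (OA : set (set A)) (OB : set (set B)) (p : A -> B) : Prop :=
  forall X : Type,
    set_surj (zero_convergent OA (X := X)) (zero_convergent OB (X := X))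
      (fun a => p \o a).

Section Maps.
Variables (A B : topologicalType).

Definition open_map (f : A -> B) : Prop :=
  forall U : set A, open U -> open (f @` U).

Definition closed_map (f : A -> B) : Prop :=
  forall F : set A, closed F -> closed (f @` F).

End Maps.

Section ZmodQuotientTopology.
Variables (A : topologicalZmodType) (I : zmodClosed A).

Definition top_quot : Type := quotient_topology (Quotient.quot I).
HB.instance Definition _ := Topological.copy top_quot
  (quotient_topology (Quotient.quot I)).
HB.instance Definition _ := Quotient.copy top_quot
  (quotient_topology (Quotient.quot I)).
HB.instance Definition _ := GRing.isZmodule.Build top_quot
  (@addrA (Quotient.quot I)) (@addrC (Quotient.quot I)) (@add0r (Quotient.quot I)) (@addNr (Quotient.quot I)).

End ZmodQuotientTopology.

(* The library's [topologicalLmodType] requires an ordered field with its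
   order topology. The field k is discrete here, so that continuity of the
   scaling k * V -> V amounts to continuity of scaling by each scalar. *)
Record topVectType (k : fieldType) := TopVect {
  tv_group : topologicalZmodType;
  tv_scale : k -> tv_group -> tv_group;
  tv_scaleA : forall a b v, tv_scale a (tv_scale b v) = tv_scale (a * b) v;
  tv_scale1 : left_id 1 tv_scale;
  tv_scaleDr : right_distributive tv_scale +%R;
  tv_scaleDl : forall v, {morph tv_scale^~ v : a b / a + b};
  tv_scale_continuous : forall a, continuous (tv_scale a) }.

Definition tv_sort (k : fieldType) (V : topVectType k) : Type := tv_group V.
Coercion tv_sort : topVectType >-> Sortclass.
HB.instance Definition _ k (V : topVectType k) :=
  TopologicalZmodule.copy (tv_sort V) (tv_group V).
HB.instance Definition _ k (V : topVectType k) :=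
  GRing.Zmodule_isLmodule.Build k (tv_sort V)
    (@tv_scaleA k V) (@tv_scale1 k V) (@tv_scaleDr k V) (@tv_scaleDl k V).

Section LmodQuotientTopology.
Variables (k : fieldType) (V : topVectType k) (I : zmodClosed V).
Hypothesis I_scale : forall (a : k) (v : V), v \in I -> a *: v \in I.

(* The hypothesis is an argument of the type, for the sake of the instance of
   [lmodType] below. *)
Definition top_lquot_of (_ : forall (a : k) (v : V), v \in I -> a *: v \in I) :
  Type := top_quot I.
Local Notation top_lquot := (top_lquot_of I_scale).
HB.instance Definition _ := Topological.on top_lquot.
HB.instance Definition _ := GRing.Zmodule.on top_lquot.
HB.instance Definition _ := Quotient.on top_lquot.

Definition lquot_scale (a : k) (x : top_lquot) : top_lquot :=
  \pi_(top_lquot) (a *: repr x).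

Lemma lquot_pi_eq (x y : V) :
  \pi_(top_lquot) x = \pi_(top_lquot) y <-> x - y \in I.
Proof. by rewrite Quotient.idealrBE; split=> [h|/eqP]; first exact/eqP. Qed.

Lemma lquot_pi_add (x y : V) :
  \pi_(top_lquot) (x + y) = \pi_(top_lquot) x + \pi_(top_lquot) y.
Proof. exact: (@pi_addr _ _ _ _ _ (Quotient.quot I)). Qed.

Lemma lquot_pi_scale (a : k) (x : V) :
  \pi_(top_lquot) (a *: x) = lquot_scale a (\pi_(top_lquot) x).
Proof.
apply/lquot_pi_eq; rewrite -scalerBr; apply/I_scale/lquot_pi_eq.
by rewrite reprK.
Qed.

Lemma lquot_scaleA a b (x : top_lquot) :
  lquot_scale a (lquot_scale b x) = lquot_scale (a * b) x.
Proof.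
by rewrite -[x]reprK -(lquot_pi_scale b) -!lquot_pi_scale scalerA.
Qed.

Lemma lquot_scale1 : left_id 1 lquot_scale.
Proof. by move=> x; rewrite -[x]reprK -lquot_pi_scale scale1r. Qed.

Lemma lquot_scaleDr : right_distributive lquot_scale +%R.
Proof.
move=> a x y; rewrite -[x]reprK -[y]reprK -lquot_pi_add -!lquot_pi_scale.
by rewrite scalerDr lquot_pi_add.
Qed.

Lemma lquot_scaleDl (x : top_lquot) :
  {morph (fun a => lquot_scale a x) : a b / a + b}.
Proof.
by move=> a b; rewrite -[x]reprK -!lquot_pi_scale scalerDl lquot_pi_add.
Qed.

HB.instance Definition _ := GRing.Zmodule_isLmodule.Build k top_lquot
  lquot_scaleA lquot_scale1 lquot_scaleDr lquot_scaleDl.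

End LmodQuotientTopology.

Definition subgroup (A : zmodType) (U : set A) : Prop :=
  U 0 /\ forall x y, U x -> U y -> U (x - y).

Definition open_subgroup (A : PreTopologicalZmodule.type) : set (set A) :=
  [set U | open U /\ subgroup U].

Record topscZ := TopscZ {
  topscZ_sort :> topologicalZmodType;
  topscZ_linear : linear_topology (@open_subgroup topscZ_sort);
  topscZ_separated : separated (@open_subgroup topscZ_sort);
  topscZ_complete : complete (@open_subgroup topscZ_sort) }.

Lemma continuous_sub (A : topologicalType) (B : topologicalZmodType)
    (f g : A -> B) :
  continuous f -> continuous g -> continuous (fun x => f x - g x).
Proof.
move=> fc gc x.
apply: (@continuous_comp _ _ _ (fun x => (f x, g x))
  (fun z : B * B => z.1 - z.2)).
  by apply: cvg_pair; [exact: fc|exact: gc].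
exact: sub_continuous.
Qed.

Section HomZ.
Variables A B : topologicalZmodType.

Definition homZ_pred : {pred A -> B} :=
  fun f => `[< zmod_morphism f /\ continuous f >].

Record homZ := HomZ { homZ_fun :> A -> B; homZP : homZ_fun \in homZ_pred }.
HB.instance Definition _ := [isSub for homZ_fun].
HB.instance Definition _ := [Choice of homZ by <:].

Lemma homZ_pred_closed : zmod_closed homZ_pred.
Proof.
split=> [|f g].
  by apply/asboolP; split=> [x y|x]; [rewrite /= subr0|exact: cvg_cst].
move=> /asboolP [fD fc] /asboolP [gD gc]; apply/asboolP; split.
  move=> x y; change (f (x - y) - g (x - y) = (f x - g x) - (f y - g y)).
  by rewrite fD gD !opprB addrACA [RHS]addrACA; congr (_ + _); rewrite addrC.
exact: continuous_sub fc gc.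
Qed.
HB.instance Definition _ := GRing.isZmodClosed.Build (A -> B) homZ_pred
  homZ_pred_closed.
HB.instance Definition _ := [SubChoice_isSubZmodule of homZ by <:].

Lemma homZ_zmod_morphism (f : homZ) : zmod_morphism f.
Proof. by have /asboolP [] := homZP f. Qed.
HB.instance Definition _ (f : homZ) :=
  GRing.isZmodMorphism.Build A B f (homZ_zmod_morphism f).

Lemma homZ_continuous (f : homZ) : continuous f.
Proof. by have /asboolP [] := homZP f. Qed.

End HomZ.

Section CompZ.

Lemma homZ_id_subproof (A : topologicalZmodType) : idfun \in @homZ_pred A A.
Proof. by apply/asboolP; split=> [//|x]; exact: cvg_id. Qed.

Definition homZ_id (A : topologicalZmodType) : homZ A A :=
  HomZ (homZ_id_subproof A).

Lemma homZ_comp_subproof (A B C : topologicalZmodType)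
    (g : homZ B C) (f : homZ A B) : g \o f \in @homZ_pred A C.
Proof.
apply/asboolP; split=> [x y|x]; first by rewrite /= !raddfB.
by apply: continuous_comp; apply: homZ_continuous.
Qed.

Definition homZ_comp (A B C : topologicalZmodType)
    (g : homZ B C) (f : homZ A B) : homZ A C := HomZ (homZ_comp_subproof g f).

Variables A B C D : topologicalZmodType.

Lemma homZ_compA (h : homZ C D) (g : homZ B C) (f : homZ A B) :
  homZ_comp h (homZ_comp g f) = homZ_comp (homZ_comp h g) f.
Proof. exact: val_inj. Qed.

Lemma homZ_comp1m (f : homZ A B) : homZ_comp (homZ_id B) f = f.
Proof. exact: val_inj. Qed.

Lemma homZ_compm1 (f : homZ A B) : homZ_comp f (homZ_id A) = f.
Proof. exact: val_inj. Qed.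

Lemma homZ_compDl (g g' : homZ B C) (f : homZ A B) :
  homZ_comp (g + g') f = homZ_comp g f + homZ_comp g' f.
Proof. exact: val_inj. Qed.

Lemma homZ_compDr (g : homZ B C) (f f' : homZ A B) :
  homZ_comp g (f + f') = homZ_comp g f + homZ_comp g f'.
Proof. by apply/val_inj/funext => x; exact: (raddfD g (f x) (f' x)). Qed.

End CompZ.

Definition TopscZ_cat : preadditive := @Preadditive topscZ
  (fun A B => homZ A B) (fun A => homZ_id A)
  (fun A B C => @homZ_comp A B C)
  (fun A B C D => @homZ_compA A B C D)
  (fun A B => @homZ_comp1m A B) (fun A B => @homZ_compm1 A B)
  (fun A B C => @homZ_compDl A B C) (fun A B C => @homZ_compDr A B C).

Definition strongly_surjectiveZ (A B : topologicalZmodType) (p : A -> B) :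
    Prop :=
  strongly_surjective_for (@open_subgroup A) (@open_subgroup B) p.

Section StronglyClosedZ.
Variables (K A : topscZ) (i : homZ K A).

Definition imageZ : {pred A} := fun a => `[< exists x, i x = a >].

Lemma imageZ_closed : zmod_closed imageZ.
Proof.
split=> [|_ _ /asboolP [x <-] /asboolP [y <-]]; apply/asboolP.
  by exists 0; rewrite raddf0.
by exists (x - y); rewrite raddfB.
Qed.
HB.instance Definition _ := GRing.isZmodClosed.Build A imageZ imageZ_closed.

Definition cokerZ : Type := top_quot imageZ.
HB.instance Definition _ := Topological.on cokerZ.
HB.instance Definition _ := GRing.Zmodule.on cokerZ.
HB.instance Definition _ := Quotient.on cokerZ.

Definition strongly_closedZ : Prop :=
  [/\ injective i, closed_map i, complete (@open_subgroup cokerZ)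
    & strongly_surjective_for (@open_subgroup A) (@open_subgroup cokerZ)
        (\pi_cokerZ : A -> cokerZ)].

End StronglyClosedZ.

Definition subspace (k : fieldType) (V : lmodType k) (U : set V) : Prop :=
  U 0 /\ forall (a : k) (u v : V), U u -> U v -> U (a *: u + v).

Notation open_subspace V := [set U : set V | open U /\ subspace U].

Record topscK (k : fieldType) := TopscK {
  topscK_sort :> topVectType k;
  topscK_linear : linear_topology (open_subspace topscK_sort);
  topscK_separated : separated (open_subspace topscK_sort);
  topscK_complete : complete (open_subspace topscK_sort) }.

Section HomK.
Variables (k : fieldType) (V W : topVectType k).

Definition homK_pred : {pred V -> W} :=
  fun f => `[< linear f /\ continuous f >].

Record homK := HomK { homK_fun :> V -> W; homKP : homK_fun \in homK_pred }.
HB.instance Definition _ := [isSub for homK_fun].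
HB.instance Definition _ := [Choice of homK by <:].

Lemma homK_pred_closed : zmod_closed homK_pred.
Proof.
split=> [|f g].
  apply/asboolP; split=> [a x y|x]; last exact: cvg_cst.
  by rewrite /= scaler0 addr0.
move=> /asboolP [fL fc] /asboolP [gL gc]; apply/asboolP; split.
  move=> a x y.
  change (f (a *: x + y) - g (a *: x + y) = a *: (f x - g x) + (f y - g y)).
  by rewrite fL gL scalerBr opprD addrACA.
exact: continuous_sub fc gc.
Qed.
HB.instance Definition _ := GRing.isZmodClosed.Build (V -> W) homK_pred
  homK_pred_closed.
HB.instance Definition _ := [SubChoice_isSubZmodule of homK by <:].

Lemma homK_linear (f : homK) : linear f.
Proof. by have /asboolP [] := homKP f. Qed.
HB.instance Definition _ (f : homK) :=
  GRing.isLinear.Build k V W *:%R f (homK_linear f).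

Lemma homK_continuous (f : homK) : continuous f.
Proof. by have /asboolP [] := homKP f. Qed.

End HomK.

Section CompK.
Variable k : fieldType.

Lemma homK_id_subproof (V : topVectType k) : idfun \in @homK_pred k V V.
Proof. by apply/asboolP; split=> [//|x]; exact: cvg_id. Qed.

Definition homK_id (V : topVectType k) : homK V V := HomK (homK_id_subproof V).

Lemma homK_comp_subproof (A B C : topVectType k)
    (g : homK B C) (f : homK A B) : g \o f \in @homK_pred k A C.
Proof.
apply/asboolP; split=> [a x y|x]; first by rewrite /= !linearP.
by apply: continuous_comp; apply: homK_continuous.
Qed.

Definition homK_comp (A B C : topVectType k)
    (g : homK B C) (f : homK A B) : homK A C := HomK (homK_comp_subproof g f).

Variables A B C D : topVectType k.

Lemma homK_compA (h : homK C D) (g : homK B C) (f : homK A B) :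
  homK_comp h (homK_comp g f) = homK_comp (homK_comp h g) f.
Proof. exact: val_inj. Qed.

Lemma homK_comp1m (f : homK A B) : homK_comp (homK_id B) f = f.
Proof. exact: val_inj. Qed.

Lemma homK_compm1 (f : homK A B) : homK_comp f (homK_id A) = f.
Proof. exact: val_inj. Qed.

Lemma homK_compDl (g g' : homK B C) (f : homK A B) :
  homK_comp (g + g') f = homK_comp g f + homK_comp g' f.
Proof. exact: val_inj. Qed.

Lemma homK_compDr (g : homK B C) (f f' : homK A B) :
  homK_comp g (f + f') = homK_comp g f + homK_comp g f'.
Proof. by apply/val_inj/funext => x; exact: (raddfD g (f x) (f' x)). Qed.

End CompK.

Definition TopscK_cat (k : fieldType) : preadditive := @Preadditive (topscK k)
  (fun A B => homK A B) (fun A => homK_id A)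
  (fun A B C => @homK_comp k A B C)
  (fun A B C D => @homK_compA k A B C D)
  (fun A B => @homK_comp1m k A B) (fun A B => @homK_compm1 k A B)
  (fun A B C => @homK_compDl k A B C) (fun A B C => @homK_compDr k A B C).

Definition strongly_surjectiveK (k : fieldType) (V W : topVectType k)
    (p : V -> W) : Prop :=
  strongly_surjective_for (open_subspace V) (open_subspace W) p.

Section StronglyClosedK.
Variables (k : fieldType) (K V : topscK k) (i : homK K V).

Definition imageK : {pred V} := fun v => `[< exists x, i x = v >].

Lemma imageK_closed : zmod_closed imageK.
Proof.
split=> [|_ _ /asboolP [x <-] /asboolP [y <-]]; apply/asboolP.
  by exists 0; rewrite raddf0.
by exists (x - y); rewrite raddfB.
Qed.
HB.instance Definition _ := GRing.isZmodClosed.Build V imageK imageK_closed.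

Lemma imageK_scale (a : k) (v : V) : v \in imageK -> a *: v \in imageK.
Proof.
by move=> /asboolP [x <-]; apply/asboolP; exists (a *: x); rewrite linearZ.
Qed.

Definition cokerK : Type := top_lquot_of imageK_scale.
HB.instance Definition _ := Topological.on cokerK.
HB.instance Definition _ := GRing.Lmodule.on cokerK.
HB.instance Definition _ := Quotient.on cokerK.

Definition strongly_closedK : Prop :=
  [/\ injective i, closed_map i, complete (open_subspace cokerK)
    & strongly_surjective_for (open_subspace V) (open_subspace cokerK)
        (\pi_cokerK : V -> cokerK)].

End StronglyClosedK.

(* Main.v *)
Require Import Defs.
From mathcomp Require Import all_boot all_algebra.
From mathcomp Require Import topology pseudometric_normed_Zmodule tvs.
From HB Require Import structures.
From mathcomp Require Import generic_quotient ring_quotient finmap.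
From mathcomp Require Import boolp classical_sets functions cardinality fsbigop.
Import Defs.

(** Topological abelian groups and topological vector spaces with linear
topology are treated together.  Both categories carry a [linear_model]: an
object is an R-module with a separated and complete filter of open submodules
(R is the ring of integers, resp. the field k), the morphisms are all the
continuous linear maps, and every R-module with a separated and complete base
of submodules occurs.  Completeness means that every compatible family of
cosets has a common point; stated this way, completeness of a quotient A / S is
a property of the cosets in A of the open submodules containing S, and
quotients can be avoided in most arguments.

The strong structure and the maximal one are the two extreme cases of
[lifting_class m P]: the sequences satisfying Ex1 along which the
zero-convergent families indexed by any X in the class P lift.  For P the class
of all types this is the strong structure; for P the class of one-point types
it only says that p is surjective.  In both cases p is surjective, and then Ex1
amounts to the elementary conditions [strict]: i is an embedding onto the
kernel of p, and p is open ([Ex1_strict]; for an open submodule U of A, the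
quotient A / (U + i(K)) is discrete, hence complete, so the projection onto it
factors through the cokernel p, which makes p(U) open).  It follows that the
admissible epimorphisms are the open lifting maps ([lifting_epiP]) and the
admissible monomorphisms the closed embeddings with complete quotient and
lifting projection ([lifting_monoP]).

The axioms on epimorphisms are then direct.  Composites of admissible
monomorphisms are admissible because an extension of complete modules is
complete ([lifting_mono_comp]).  For the pushout of i : K -> A along
f : K -> L, the map (i, - f) : K -> A + L is the composite of the graph of - f,
which is split, and of the sum of i and the identity of L; so it is an
admissible monomorphism, and its cokernel is the pushout ([lifting_pushout]).

For maximality, let p : A -> B be an admissible epimorphism of some exact
structure and y a point of B.  Pull p back along the map from the discrete
module R that hits y: the pullback is a cokernel with discrete target, hence
surjective, and y is in the image of p ([exact_epi_surj]).

Finally, the two structures differ: let A be the module of finitely supported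
functions from an uncountable set to the product R^N, where a basic neighborhood
of zero consists of the functions that vanish on a given countable set and have
all their values in a given neighborhood of zero.  This A is complete, every
zero-convergent sequence in it is eventually zero, and the sum of the values is
an open surjection onto R^N, in which the standard unit vectors form a
zero-convergent sequence ([open_surjective_not_lifting]). *)

Set Implicit Arguments.
Unset Strict Implicit.
Unset Printing Implicit Defensive.

Import GRing.Theory.
Local Open Scope classical_set_scope.
Local Open Scope ring_scope.
Local Open Scope quotient_scope.

(** * Families of subgroups *)
Section Families.
Variable M : zmodType.
Implicit Types (B : set (set M)) (S : set M).

Definition fam_separated B := forall x, (forall U, B U -> U x) -> x = 0.

(** The set [c U + U] is a coset of [U], and the hypothesis on [c] is the
compatibility of these cosets. *)
Definition fam_complete B := forall c : set M -> M,
  (forall U V, B U -> B V -> U `<=` V -> V (c U - c V)) ->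
  exists a, forall U, B U -> U (a - c U).

(** The open subgroups of a quotient by [S] correspond to the open subgroups
above [S]; replacing a family by its part above [S] describes the quotient
without forming it. *)
Definition above B S : set (set M) := [set U | B U /\ S `<=` U].

Definition null_family B (X : Type) (a : X -> M) :=
  forall U, B U -> finite_set [set x | ~ U (a x)].

(** Closedness of [S] in the topology with base [B]. *)
Definition fam_closed B S :=
  forall x, (forall U, B U -> exists2 s, S s & U (x - s)) -> S x.

(** The quotient map by [S] lifts zero-convergent families, read in the group
itself. *)
Definition lifts_mod (P : Type -> Prop) B S :=
  forall X, P X -> forall c : X -> M, null_family (above B S) c ->
  exists2 a : X -> M, null_family B a & forall x, S (a x - c x).

End Families.

(** * Submodules and quotient modules *)
Section SubmoduleConstructions.
Variable R : nzRingType.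

Definition submodule (M : lmodType R) (U : set M) : Prop :=
  U 0 /\ forall a u v, U u -> U v -> U (a *: u + v).

Section Closure.
Variables (M : lmodType R) (U : set M).
Hypothesis sU : submodule U.

Lemma submod0 : U 0. Proof. by case: sU. Qed.
Lemma submodD x y : U x -> U y -> U (x + y).
Proof. by move=> Ux Uy; rewrite -[x]scale1r; case: sU => _; apply. Qed.
Lemma submodZ a x : U x -> U (a *: x).
Proof. by move=> Ux; rewrite -[_ *: _]addr0; case: sU => ? ; apply. Qed.
Lemma submodN x : U x -> U (- x).
Proof. by move=> Ux; rewrite -scaleN1r; exact: submodZ. Qed.
Lemma submodB x y : U x -> U y -> U (x - y).
Proof. by move=> Ux Uy; apply: submodD => //; exact: submodN. Qed.
Lemma submod_sym x y : U (x - y) -> U (y - x).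
Proof. by move=> /submodN; rewrite opprB. Qed.
Lemma submod_trans y x z : U (x - y) -> U (y - z) -> U (x - z).
Proof. by move=> h1 h2; have := submodD h1 h2; rewrite addrA subrK. Qed.
End Closure.

Lemma submoduleT (M : lmodType R) : submodule [set: M].
Proof. by []. Qed.

Lemma submodule1 (M : lmodType R) : submodule [set (0 : M)].
Proof. by split=> // a u v -> ->; rewrite scaler0 addr0. Qed.

Lemma submoduleI (M : lmodType R) (U V : set M) :
  submodule U -> submodule V -> submodule (U `&` V).
Proof.
by move=> [U0 hU] [V0 hV]; split=> // a u v [? ?] [? ?]; split; auto.
Qed.

Lemma submodule_preim (M N : lmodType R) (f : {linear M -> N}) (V : set N) :
  submodule V -> submodule (f @^-1` V).
Proof.
move=> sV; split=> [|a u v]; first by rewrite /preimage /= linear0; exact: submod0.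
by rewrite /preimage /= linearP; case: sV => _; apply.
Qed.

Lemma submodule_im (M N : lmodType R) (f : {linear M -> N}) (U : set M) :
  submodule U -> submodule (f @` U).
Proof.
move=> sU; split=> [|a _ _ [u Uu <-] [v Uv <-]].
  by exists 0; rewrite ?linear0 //; exact: submod0.
by exists (a *: u + v); rewrite ?linearP //; case: sU => _; apply.
Qed.

(** Bundling the proof lets the types [sub_lmod] and [quot_lmod] below be
inferred as modules from [S] alone. *)
Record submod (M : lmodType R) :=
  Submod { submod_set : set M; submodP : submodule submod_set }.

Section SubAndQuotient.
Variables (M : lmodType R) (S : submod M).

Definition submod_pred : {pred M} := fun x => `[< submod_set S x >].

Lemma submod_predE x : (x \in submod_pred) <-> submod_set S x.
Proof. by split=> /asboolP. Qed.

Lemma submod_pred_closed : submod_closed submod_pred.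
Proof.
split=> [|a x y /asboolP Sx /asboolP Sy]; apply/asboolP.
  exact: submod0 (submodP S).
by case: (submodP S) => _; apply.
Qed.
HB.instance Definition _ := GRing.isSubmodClosed.Build R M submod_pred
  submod_pred_closed.

Record sub_lmod := SubLmod
  { sub_lmod_val :> M; sub_lmodP : sub_lmod_val \in submod_pred }.
HB.instance Definition _ := [isSub for sub_lmod_val].
HB.instance Definition _ := [Choice of sub_lmod by <:].
HB.instance Definition _ := [SubChoice_isSubLmodule of sub_lmod by <:].

Definition quot_lmod : Type := Quotient.quot submod_pred.
HB.instance Definition _ := GRing.Zmodule.on quot_lmod.
HB.instance Definition _ := Quotient.on quot_lmod.

Definition quot_scale (a : R) (x : quot_lmod) : quot_lmod :=
  \pi_quot_lmod (a *: repr x).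

Lemma quot_piE (x y : M) :
  \pi_quot_lmod x = \pi_quot_lmod y <-> submod_set S (x - y).
Proof.
by rewrite -submod_predE Quotient.idealrBE; split=> [h|/eqP]; first exact/eqP.
Qed.

Lemma quot_piD (x y : M) :
  \pi_quot_lmod (x + y) = \pi_quot_lmod x + \pi_quot_lmod y.
Proof. exact: (@pi_addr _ _ _ _ _ (Quotient.quot submod_pred)). Qed.

Lemma quot_piZ (a : R) (x : M) :
  \pi_quot_lmod (a *: x) = quot_scale a (\pi_quot_lmod x).
Proof.
apply/quot_piE; rewrite -scalerBr; apply: submodZ; first exact: submodP.
by apply/quot_piE; rewrite reprK.
Qed.

Lemma quot_scaleA a b (x : quot_lmod) :
  quot_scale a (quot_scale b x) = quot_scale (a * b) x.
Proof. by rewrite -[x]reprK -(quot_piZ b) -!quot_piZ scalerA. Qed.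

Lemma quot_scale1 : left_id 1 quot_scale.
Proof. by move=> x; rewrite -[x]reprK -quot_piZ scale1r. Qed.

Lemma quot_scaleDr : right_distributive quot_scale +%R.
Proof.
move=> a x y; rewrite -[x]reprK -[y]reprK -quot_piD -!quot_piZ.
by rewrite scalerDr quot_piD.
Qed.

Lemma quot_scaleDl (x : quot_lmod) : {morph quot_scale^~ x : a b / a + b}.
Proof.
by move=> a b; rewrite -[x]reprK -!quot_piZ scalerDl quot_piD.
Qed.

HB.instance Definition _ := GRing.Zmodule_isLmodule.Build R quot_lmod
  quot_scaleA quot_scale1 quot_scaleDr quot_scaleDl.

Definition quot_pi (x : M) : quot_lmod := \pi_quot_lmod x.

Lemma quot_pi_linear : linear quot_pi.
Proof. by move=> a x y; rewrite /quot_pi quot_piD quot_piZ. Qed.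
HB.instance Definition _ := GRing.isLinear.Build R M quot_lmod *:%R quot_pi
  quot_pi_linear.

Lemma quot_pi_eq0 x : quot_pi x = 0 <-> submod_set S x.
Proof. by rewrite -(linear0 quot_pi) /quot_pi quot_piE subr0. Qed.

Lemma quot_pi_surj y : exists x, quot_pi x = y.
Proof. by exists (repr y); rewrite /quot_pi reprK. Qed.

End SubAndQuotient.

Record linear_base (M : lmodType R) (B : set (set M)) : Prop := {
  base_submodule : forall U, B U -> submodule U;
  base_nonempty : exists U, B U;
  base_meet : forall U V, B U -> B V -> exists2 W, B W & W `<=` U `&` V }.

End SubmoduleConstructions.

(** * Surjections compatible with families of subgroups *)
Definition lifts_along (P : Type -> Prop) (M N : zmodType) (BM : set (set M))
    (BN : set (set N)) (p : M -> N) : Prop :=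
  forall X, P X -> forall c : X -> N, null_family BN c ->
  exists2 a : X -> M, null_family BM a & forall x, p (a x) = c x.

Section Subgroup.
Variables (M : zmodType) (U : set M).
Hypothesis sU : subgroup U.
Lemma subgrpB x y : U x -> U y -> U (x - y).
Proof. by case: sU => _; apply. Qed.
Lemma subgrpN x : U x -> U (- x).
Proof. by move=> Ux; rewrite -sub0r; apply: subgrpB => //; case: sU. Qed.
Lemma subgrpD x y : U x -> U y -> U (x + y).
Proof. by move=> Ux Uy; rewrite -[y]opprK; apply: subgrpB => //; exact: subgrpN. Qed.
Lemma subgrp_sub x y : U (x - y) -> U y -> U x.
Proof. by move=> h Uy; rewrite -(subrK y x); exact: subgrpD. Qed.
End Subgroup.

(** Here [p] is an open continuous surjection with kernel [S].  The subgroups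
above the kernel are the saturated ones, so only their images matter. *)
Section OpenSurjection.
Variables (M N : zmodType) (p : {additive M -> N}).
Variables (BM : set (set M)) (BN : set (set N)) (S : set M).
Hypothesis p_surj : forall y, exists x, p x = y.
Hypothesis p_ker : forall x, p x = 0 <-> S x.
Hypothesis sBM : forall U, BM U -> subgroup U.
Hypothesis p_cont : forall V, BN V -> BM (p @^-1` V).
Hypothesis p_open : forall U, BM U -> S `<=` U -> BN (p @` U).

Let preim_above V : BN V -> above BM S (p @^-1` V).
Proof.
move=> BV; split; first exact: p_cont.
move=> x /p_ker px0; rewrite /preimage /= px0.
by have [] := sBM (p_cont BV); rewrite /preimage /= raddf0.
Qed.

Let im_mem U x : above BM S U -> (p @` U) (p x) -> U x.
Proof.
move=> [BU SU] [u Uu pxu].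
apply: (subgrp_sub (sBM BU) _ Uu); apply: SU; apply/p_ker.
by rewrite raddfB pxu subrr.
Qed.

(** Coset families of [N] and of the part of [BM] above [S] correspond to each
other by image and preimage. *)
Lemma fam_complete_quotient : fam_complete (above BM S) <-> fam_complete BN.
Proof.
have [r pr] := choice p_surj; split=> cpl c cc.
- have [|a ha] := cpl (fun U => r (c (p @` U))).
    move=> U V [BU SU] aV UV; apply: (im_mem aV).
    case: (aV) => BV SV.
    rewrite raddfB /= !pr; apply: (cc (p @` U) (p @` V)); try exact: p_open.
    exact: image_subset.
  exists (p a) => V BV.
  have := ha _ (preim_above BV); rewrite /preimage /= raddfB /= pr.
  suff -> : p @` [set x | V (p x)] = V by [].
  by apply/seteqP; split=> [_ [x Vx <-]//|y Vy]; exists (r y); rewrite /= pr.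
- have [|e he] := cpl (fun V => p (c (p @^-1` V))).
    move=> U V BU BV UV; rewrite -raddfB.
    apply: (cc _ _ (preim_above BU) (preim_above BV)).
    exact: preimage_subset.
  exists (r e) => U aU; apply: (im_mem aU).
  have [BU SU] := aU.
  have pU : p @^-1` (p @` U) = U.
    by apply/seteqP; split=> [x|x Ux]; [exact: im_mem | exists x].
  by have := he _ (p_open BU SU); rewrite pU raddfB /= pr.
Qed.

Lemma lifts_mod_quotient P : lifts_mod P BM S <-> lifts_along P BM BN p.
Proof.
have [r pr] := choice p_surj; split=> lft X PX c nc.
- have [|a na ac] := lft X PX (r \o c).
    move=> U aU; have [BU SU] := aU.
    apply: sub_finite_set (nc _ (p_open BU SU)) => x /= nU pU; apply: nU.
    by apply: (im_mem aU); rewrite pr.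
  exists a => // x; apply/eqP; rewrite -subr_eq0 -[c x]pr -raddfB.
  by apply/eqP/p_ker/ac.
- have [|a na ac] := lft X PX (p \o c).
    by move=> V BV; exact: nc (preim_above BV).
  by exists a => // x; apply/p_ker; rewrite raddfB ac subrr.
Qed.

(** The quotient is Hausdorff exactly when the kernel is closed. *)
Lemma fam_separated_quotient :
  (forall U, BM U -> BM [set x | exists2 s, S s & U (x - s)]) ->
  fam_closed BM S <-> fam_separated BN.
Proof.
move=> sumS; split=> h.
- move=> y hy; have [x xy] := p_surj y; subst y; apply/p_ker/h => U BU.
  have S0 : S 0 by apply/p_ker; rewrite raddf0.
  have BW := sumS _ BU.
  have SW : S `<=` [set x | exists2 s, S s & U (x - s)].
    by move=> s Ss; exists s; rewrite // subrr; case: (sBM BU).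
  by have := hy _ (p_open BW SW); apply: im_mem.
- move=> x hx; apply/p_ker/h => V BV; have [s Ss] := hx _ (p_cont BV).
  by move/p_ker: Ss => ps; rewrite /preimage /= raddfB /= ps subr0.
Qed.

End OpenSurjection.

(** * Categories of linearly topologized modules *)

(** A preadditive category [C] together with an identification of its objects
with complete separated linearly topologized R-modules and of its morphisms
with the continuous linear maps; [lm_object] is essential surjectivity. *)
Record linear_model (R : nzRingType) (C : preadditive) := LinearModel {
  lm_car : C -> lmodType R;
  lm_open : forall A : C, set (set (lm_car A));
  lm_fun : forall A B : C, hom A B -> {linear lm_car A -> lm_car B};
  lm_open_submodule : forall A U, @lm_open A U -> submodule U;
  lm_openT : forall A, @lm_open A setT;
  lm_openI : forall A U V, @lm_open A U -> @lm_open A V -> @lm_open A (U `&` V);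
  lm_open_up : forall A U V,
    @lm_open A U -> submodule V -> U `<=` V -> @lm_open A V;
  lm_separated : forall A, fam_separated (@lm_open A);
  lm_complete : forall A, fam_complete (@lm_open A);
  lm_fun_continuous : forall A B (f : hom A B) V,
    lm_open V -> lm_open (lm_fun f @^-1` V);
  lm_fun_faithful : forall A B (f g : hom A B), lm_fun f =1 lm_fun g -> f = g;
  lm_fun_full : forall A B (h : {linear lm_car A -> lm_car B}),
    (forall V, lm_open V -> lm_open (h @^-1` V)) ->
    exists f : hom A B, lm_fun f =1 h;
  lm_funD : forall A B (f g : hom A B) x,
    lm_fun (f + g) x = lm_fun f x + lm_fun g x;
  lm_fun_comp : forall A B D (g : hom B D) (f : hom A B) x,
    lm_fun (g \oc f) x = lm_fun g (lm_fun f x);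
  lm_fun_id : forall A x, lm_fun (idm A) x = x;
  lm_object : forall (M : lmodType R) (B : set (set M)),
    linear_base B -> fam_separated B -> fam_complete B ->
    exists (A : C) (phi : {linear M -> lm_car A}), bijective phi /\
      forall W, lm_open W <->
        submodule W /\ exists2 U, B U & U `<=` phi @^-1` W }.

Section Model.
Variables (R : nzRingType) (C : preadditive) (m : linear_model R C).
Local Notation car := (lm_car m).
Local Notation opn A := (@lm_open R C m A).
Local Notation fn := (lm_fun m).
Implicit Types A B D K L Q : C.

Lemma fn0 A B x : fn (0 : hom A B) x = 0.
Proof.
by apply: (addrI (fn (0 : hom A B) x)); rewrite -lm_funD !addr0.
Qed.

Lemma fnN A B (f : hom A B) x : fn (- f) x = - fn f x.
Proof. by apply/eqP; rewrite -addr_eq0 -lm_funD addNr fn0. Qed.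

Lemma fnB A B (f g : hom A B) x : fn (f - g) x = fn f x - fn g x.
Proof. by rewrite lm_funD fnN. Qed.

Lemma comp_eq A B D (g : hom B D) (f : hom A B) (h : hom A D) :
  g \oc f = h -> forall x, fn g (fn f x) = fn h x.
Proof. by move=> <- x; rewrite lm_fun_comp. Qed.

Lemma comp_eq0 A B D (g : hom B D) (f : hom A B) :
  g \oc f = 0 -> forall x, fn g (fn f x) = 0.
Proof. by move=> h x; rewrite (comp_eq h) fn0. Qed.

Lemma opn_subgroup A U : opn A U -> subgroup U.
Proof.
move=> /lm_open_submodule sU; split; first exact: submod0.
by move=> x y; exact: submodB.
Qed.

(** The set below is the sum of [S] and [U]. *)
Lemma opn_sum A S U : submodule S -> opn A U ->
  opn A [set x | exists2 s, S s & U (x - s)].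
Proof.
move=> sS oU; have sU := lm_open_submodule oU.
apply: (lm_open_up oU); last first.
  by move=> u Uu; exists 0; [exact: submod0 | rewrite subr0].
split=> [|a x y [s Ss Us] [t St Ut]].
  by exists 0; [exact: submod0 | rewrite subr0; exact: submod0].
exists (a *: s + t); first by case: sS => _; apply.
by rewrite opprD addrACA -scalerBr; case: sU => _; apply.
Qed.

Definition surj_hom A B (p : hom A B) := forall y, exists x, fn p x = y.
Definition open_hom A B (p : hom A B) :=
  forall U, opn A U -> opn B (fn p @` U).
Definition embedding K A (i : hom K A) :=
  forall U, opn K U -> exists2 W, opn A W & fn i @^-1` W `<=` U.
Definition ker_set A B (p : hom A B) : set (car A) := [set x | fn p x = 0].
Definition im_set A B (p : hom A B) : set (car B) := [set fn p x | x in setT].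
Definition lifts P A B (p : hom A B) := lifts_along P (opn A) (opn B) (fn p).

(** For surjective [p], these conditions say that the sequence is exact
algebraically and that both topologies are the ones induced by that of [A]. *)
Record strict K A B (i : hom K A) (p : hom A B) : Prop := Strict {
  strict_inj : injective (fn i);
  strict_ker : forall x, fn p x = 0 <-> im_set i x;
  strict_embedding : embedding i;
  strict_open : open_hom p }.

Lemma im_submodule A B (p : hom A B) : submodule (im_set p).
Proof. by apply: submodule_im; exact: submoduleT. Qed.

Lemma ker_submodule A B (p : hom A B) : submodule (ker_set p).
Proof. exact: (@submodule_preim R _ _ (fn p) _ (@submodule1 R _)). Qed.

Lemma ker_closed A B (p : hom A B) : fam_closed (opn A) (ker_set p).
Proof.
move=> x hx; apply: lm_separated => V oV.
have [s ps] := hx _ (lm_fun_continuous p oV).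
by rewrite /preimage /= raddfB /= ps subr0.
Qed.

(** The open submodules of the quotient are those whose preimage is open;
separatedness and completeness of the quotient are the two hypotheses. *)
Lemma quot_obj A S : submodule S -> fam_closed (opn A) S ->
  fam_complete (above (opn A) S) ->
  exists Q (q : hom A Q), [/\ surj_hom q, forall x, fn q x = 0 <-> S x
    & open_hom q].
Proof.
move=> sS clS cplS; pose T := Submod sS.
pose pi : {linear car A -> quot_lmod T} := @quot_pi R _ T.
pose B : set (set (quot_lmod T)) := [set V | submodule V /\ opn A (pi @^-1` V)].
have sB U : opn A U -> subgroup U by exact: opn_subgroup.
have piU U : opn A U -> B (pi @` U).
  move=> oU; have sU := lm_open_submodule oU; split.
    exact: submodule_im.
  apply: (lm_open_up oU); first exact/submodule_preim/submodule_im.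
  by move=> x Ux; exists x.
have piO U : opn A U -> S `<=` U -> B (pi @` U) by move=> oU _; exact: piU.
have piC V : B V -> opn A (pi @^-1` V) by case.
have piK x : pi x = 0 <-> S x by rewrite /pi quot_pi_eq0.
have piS : forall y, exists x, pi x = y by exact: quot_pi_surj.
have bB : linear_base B.
  split=> [U []//||U V [sU oU] [sV oV]].
    exists setT; split; first exact: submoduleT.
    by rewrite preimage_setT; exact: lm_openT.
  exists (U `&` V) => //; split; first exact: submoduleI.
  by rewrite preimage_setI; exact: lm_openI.
have sepB : fam_separated B.
  apply/(fam_separated_quotient piS piK sB piC piO) => // U oU.
  exact: opn_sum.
have cplB : fam_complete B.
  exact/(fam_complete_quotient piS piK sB piC piO).
have [Q [phi [[psi phiK psiK] oQ]]] := lm_object m bB sepB cplB.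
have [|q qE] := @lm_fun_full _ _ m A Q (phi \o pi).
  move=> W /oQ [sW [V [_ oV] VW]]; apply: (lm_open_up oV).
    exact: (submodule_preim (phi \o pi) sW).
  by move=> x /VW.
exists Q, q; split.
- by move=> y; have [x xy] := piS (psi y); exists x; rewrite qE /= xy psiK.
- move=> x; rewrite qE /= -piK; split=> [h|->]; last by rewrite linear0.
  by apply: (can_inj phiK); rewrite h linear0.
- move=> U oU; apply/oQ; split.
    exact/submodule_im/lm_open_submodule.
  exists (pi @` U); first exact: piU.
  by move=> _ [x Ux <-]; exists x; rewrite ?qE.
Qed.
End Model.

(** * Subobjects, biproducts and a discrete generator *)
Section Objects.
Variables (R : nzRingType) (C : preadditive) (m : linear_model R C).
Local Notation car := (lm_car m).
Local Notation opn A := (@lm_open R C m A).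
Local Notation fn := (lm_fun m).
Implicit Types A B D K L Q : C.

(** An open submodule is closed, and completeness above it is trivial because
the family has a least member. *)
Lemma discrete_quot A S : opn A S ->
  exists Q (q : hom A Q), [/\ surj_hom m q, forall x, fn q x = 0 <-> S x
    & opn Q [set 0]].
Proof.
move=> oS; have sS := lm_open_submodule oS.
have [||Q [q [qs qk qo]]] := quot_obj sS.
- by move=> x /(_ _ oS) [s Ss xs]; rewrite -(subrK s x); exact: submodD.
- move=> c cc; by exists (c S) => U [oU SU]; apply: (cc S U); by [split|].
exists Q, q; split=> //; have := qo _ oS; congr (opn _ _).
apply/seteqP; split=> [_ [x Sx <-]|_ ->]; first exact/qk.
by exists 0; [exact: submod0 | rewrite linear0].
Qed.

(** A closed submodule of a complete module is complete: the common point of a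
family of cosets that meet the submodule is approximated by its points. *)
Lemma sub_obj A S : submodule S -> fam_closed (opn A) S ->
  exists K (j : hom K A), [/\ injective (fn j), im_set j = S
    & embedding m j].
Proof.
move=> sS clS; pose T := Submod sS.
pose v : {linear sub_lmod T -> car A} := val.
pose B : set (set (sub_lmod T)) := [set v @^-1` U | U in opn A].
have vS y : S (v y) by apply/(@submod_predE R _ T)/(sub_lmodP y).
have Sv x : S x -> exists y, v y = x.
  by move=> /(@submod_predE R _ T) Sx; exists (SubLmod Sx).
have bB : linear_base B.
  split=> [_ [U oU <-]||_ _ [U oU <-] [V oV <-]].
  - exact: submodule_preim (lm_open_submodule oU).
  - by exists (v @^-1` setT), setT => //; exact: lm_openT.
  - exists (v @^-1` (U `&` V)) => //; exists (U `&` V) => //.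
    exact: lm_openI.
have sepB : fam_separated B.
  move=> y hy; apply: val_inj; apply: lm_separated => U oU.
  by apply: (hy (v @^-1` U)); exists U.
have cplB : fam_complete B.
  move=> c cc; have [|a ha] := @lm_complete _ _ m A (fun U => v (c (v @^-1` U))).
    move=> U V oU oV UV; rewrite -raddfB.
    by apply: (cc (v @^-1` U) (v @^-1` V)); [exists U|exists V|exact: preimage_subset].
  have Sa : S a.
    apply: clS => U oU; exists (v (c (v @^-1` U))); [exact: vS|exact: ha].
  have [y ya] := Sv _ Sa; exists y => _ [U oU <-].
  change (U (v (y - c (v @^-1` U)))).
  by rewrite raddfB; have := ha _ oU; rewrite -ya.
have [K [phi [[psi phiK psiK] oK]]] := lm_object m bB sepB cplB.
have psi_lin : linear psi.
  by move=> a x y; apply: (can_inj phiK); rewrite linearP !psiK.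
pose psiL := GRing.isLinear.Build R (car K) (sub_lmod T) *:%R psi psi_lin.
pose psi' : {linear car K -> sub_lmod T} := HB.pack psi psiL.
have [|j jE] := @lm_fun_full _ _ m K A (v \o psi').
  move=> W oW; apply/oK; split.
    exact: (submodule_preim (v \o psi') (lm_open_submodule oW)).
  by exists (v @^-1` W); [exists W | move=> x; rewrite /preimage /= phiK].
exists K, j; split.
- by move=> x y; rewrite !jE /= => /val_inj /(can_inj psiK).
- apply/seteqP; split=> [_ [x _ <-]|x Sx]; first by rewrite jE; exact: vS.
  have [y yx] := Sv _ Sx; exists (phi y) => //; by rewrite jE /= phiK.
- move=> U /oK [sU [_ [W oW <-] WU]]; exists W => // x.
  by rewrite /preimage /= jE /= => /WU; rewrite /preimage /= psiK.
Qed.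

Lemma zero_obj : exists Z : C, is_zero_object Z.
Proof.
pose M : lmodType R := 'rV[R]_0; pose B : set (set M) := [set setT].
have M0 (x : M) : x = 0 by exact: thinmx0.
have bB : linear_base B.
  split=> [U ->||U V -> ->]; [exact: submoduleT|by exists setT|].
  by exists setT => //; rewrite setTI.
have [||Z [phi [[psi phiK psiK] _]]] := lm_object m bB.
- by move=> x _.
- by move=> c _; exists 0 => U ->.
have Z0 (z : car Z) : z = 0 by rewrite -[z]psiK [psi z]M0 linear0.
exists Z => A; split; exists 0; split=> // f _; apply: (lm_fun_faithful (l := m)) => x.
  by rewrite fn0 [x]Z0 linear0.
by rewrite fn0 [RHS]Z0.
Qed.

(** The product topology is described by its base of rectangles [U `*` V]; the
two coordinates of a coset family are read off from the rectangles with one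
full side. *)
Lemma biproduct_obj A B : exists S (iA : hom A S) (iB : hom B S)
  (pA : hom S A) (pB : hom S B), is_biproduct iA iB pA pB.
Proof.
pose M : lmodType R := (car A * car B)%type.
pose BB : set (set M) :=
  [set W | exists U V, [/\ opn A U, opn B V & W = U `*` V]].
have bB : linear_base BB.
  split.
  - move=> _ [U [V [oU oV ->]]].
    have [sU sV] := (lm_open_submodule oU, lm_open_submodule oV).
    split; first by split; exact: submod0.
    by move=> a x y [? ?] [? ?]; split; [case: sU | case: sV] => _; apply.
  - exists (setT `*` setT); exists setT, setT; split=> //; exact: lm_openT.
  - move=> _ _ [U [V [oU oV ->]]] [U' [V' [oU' oV' ->]]].
    exists ((U `&` U') `*` (V `&` V')).
      by exists (U `&` U'), (V `&` V'); split=> //; exact: lm_openI.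
    by move=> x [[? ?] [? ?]]; split; split.
have opT D := @lm_openT _ _ m D.
have sepB : fam_separated BB.
  move=> [x y] h; congr (_, _); apply: lm_separated => U oU.
    by have [] : (U `*` setT) (x, y) by apply: h; exists U, setT.
  by have [] : (setT `*` U) (x, y) by apply: h; exists setT, U.
have cplB : fam_complete BB.
  move=> c cc.
  have [|a ha] := @lm_complete _ _ m A (fun U => (c (U `*` setT)).1).
    move=> U U' oU oU' UU'.
    have [] // : (U' `*` setT) (c (U `*` setT) - c (U' `*` setT)).
    apply: cc; [by exists U, setT|by exists U', setT|].
    by move=> x [? ?]; split => //; exact: UU'.
  have [|b hb] := @lm_complete _ _ m B (fun V => (c (setT `*` V)).2).
    move=> U U' oU oU' UU'.
    have [] // : (setT `*` U') (c (setT `*` U) - c (setT `*` U')).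
    apply: cc; [by exists setT, U|by exists setT, U'|].
    by move=> x [? ?]; split => //; exact: UU'.
  exists (a, b) => _ [U [V [oU oV ->]]].
  have bW : BB (U `*` V) by exists U, V.
  have [sU sV] := (lm_open_submodule oU, lm_open_submodule oV).
  split=> /=.
    apply: (submod_trans sU (ha _ oU)); apply: submod_sym => //.
    have [] // : (U `*` setT) (c (U `*` V) - c (U `*` setT)).
    by apply: cc => //; [exists U, setT | move=> x []].
  apply: (submod_trans sV (hb _ oV)); apply: submod_sym => //.
  have [] // : (setT `*` V) (c (U `*` V) - c (setT `*` V)).
  by apply: cc => //; [exists setT, V | move=> x []].
have [S [phi [[psi phiK psiK] oS]]] := lm_object m bB sepB cplB.
have psi_lin : linear psi.
  by move=> a x y; apply: (can_inj phiK); rewrite linearP !psiK.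
pose psiL := GRing.isLinear.Build R (car S) M *:%R psi psi_lin.
pose psi' : {linear car S -> M} := HB.pack psi psiL.
have l1 : linear (fun x : car A => (x, 0) : M).
  by move=> a x y; congr (_, _); rewrite /= scaler0 addr0.
have l2 : linear (fun x : car B => (0, x) : M).
  by move=> a x y; congr (_, _); rewrite /= scaler0 addr0.
pose in1 : {linear car A -> M} := HB.pack (fun x : car A => (x, 0) : M)
  (GRing.isLinear.Build R (car A) M *:%R _ l1).
pose in2 : {linear car B -> M} := HB.pack (fun x : car B => (0, x) : M)
  (GRing.isLinear.Build R (car B) M *:%R _ l2).
pose pr1 : {linear M -> car A} := fst.
pose pr2 : {linear M -> car B} := snd.
have [|iA iAE] := @lm_fun_full _ _ m A S (phi \o in1).
  move=> W /oS [sW [_ [U [V [oU oV ->]]] UVW]].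
  apply: (lm_open_up oU); first exact: (submodule_preim (phi \o in1) sW).
  by move=> x Ux; apply: UVW; split=> //=; exact: submod0 (lm_open_submodule oV).
have [|iB iBE] := @lm_fun_full _ _ m B S (phi \o in2).
  move=> W /oS [sW [_ [U [V [oU oV ->]]] UVW]].
  apply: (lm_open_up oV); first exact: (submodule_preim (phi \o in2) sW).
  by move=> x Ux; apply: UVW; split=> //=; exact: submod0 (lm_open_submodule oU).
have [|pA pAE] := @lm_fun_full _ _ m S A (pr1 \o psi').
  move=> U oU; apply/oS; split.
    exact: (submodule_preim (pr1 \o psi') (lm_open_submodule oU)).
  exists (U `*` setT); first by exists U, setT.
  by move=> x [Ux _]; rewrite /preimage /= phiK.
have [|pB pBE] := @lm_fun_full _ _ m S B (pr2 \o psi').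
  move=> U oU; apply/oS; split.
    exact: (submodule_preim (pr2 \o psi') (lm_open_submodule oU)).
  exists (setT `*` U); first by exists setT, U.
  by move=> x [_ Ux]; rewrite /preimage /= phiK.
exists S, iA, iB, pA, pB.
split; apply: (lm_fun_faithful (l := m)) => x;
  rewrite ?lm_funD !lm_fun_comp ?lm_fun_id ?fn0 ?iAE ?iBE ?pAE ?pBE /= ?iAE ?iBE ?phiK //.
rewrite -linearD -[RHS]psiK; congr (phi _).
by rewrite [RHS]surjective_pairing; congr (_, _); rewrite /= ?addr0 ?add0r.
Qed.

(** The ring itself with the discrete topology. *)
Lemma generator_obj : exists (G : C) (g : car G), opn G [set 0] /\
  forall A (x : car A), exists f : hom G A, fn f g = x.
Proof.
pose M : lmodType R := R^o; pose B : set (set M) := [set [set 0]].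
have bB : linear_base B.
  split=> [U ->||U V -> ->]; [exact: submodule1|by exists [set 0]|].
  by exists [set 0] => //; rewrite setIid.
have [||G [phi [[psi phiK psiK] oG]]] := lm_object m bB.
- by move=> x /(_ _ erefl).
- by move=> c _; exists (c [set 0]) => U ->; rewrite subrr.
have psi_lin : linear psi.
  by move=> a x y; apply: (can_inj phiK); rewrite linearP !psiK.
pose psiL := GRing.isLinear.Build R (car G) M *:%R psi psi_lin.
pose psi' : {linear car G -> M} := HB.pack psi psiL.
exists G, (phi 1); split.
  apply/oG; split; first exact: submodule1.
  by exists [set 0] => // _ ->; rewrite /preimage /= linear0.
move=> A x.
have lx : linear (fun a : M => (a : R) *: x).
  by move=> a b c; rewrite scalerDl scalerA.
pose sx : {linear M -> car A} := HB.pack (fun a : M => (a : R) *: x)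
  (GRing.isLinear.Build R M (car A) *:%R _ lx).
have [|f fE] := @lm_fun_full _ _ m G A (sx \o psi').
  move=> W oW; apply/oG; have sW := lm_open_submodule oW; split.
    exact: (submodule_preim (sx \o psi') sW).
  by exists [set 0] => // _ ->; rewrite /preimage /= phiK scale0r; exact: submod0.
by exists f; rewrite fE /= phiK scale1r.
Qed.

End Objects.

(** * Kernel-cokernel pairs with a lifting property *)
Section Lifting.
Variables (R : nzRingType) (C : preadditive) (m : linear_model R C).
Local Notation car := (lm_car m).
Local Notation opn A := (@lm_open R C m A).
Local Notation fn := (lm_fun m).
Implicit Types A B D K L Q : C.

Lemma hom_eq A B (f g : hom A B) : (forall x, fn f x = fn g x) -> f = g.
Proof. exact: lm_fun_faithful. Qed.

(** An embedding is universal among the maps with image in its image. *)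
Lemma factor_mono T A K (i : hom K A) (t : hom T A) :
  injective (fn i) -> embedding m i -> (forall x, im_set i (fn t x)) ->
  exists u : hom T K, i \oc u = t.
Proof.
move=> inj emb it.
have ex x : exists y, fn i y = fn t x by have [y _ yx] := it x; exists y.
have [u uE] := choice ex.
have u_lin : linear u.
  by move=> a x y; apply: inj; rewrite linearP !uE linearP.
pose u' : {linear car T -> car K} := HB.pack u
  (GRing.isLinear.Build R (car T) (car K) *:%R u u_lin).
have [|v vE] := @lm_fun_full _ _ m T K u'.
  move=> U oU; have [W oW WU] := emb _ oU.
  apply: (lm_open_up (lm_fun_continuous t oW)).
    exact: (submodule_preim u' (lm_open_submodule oU)).
  by move=> x Wx; apply: WU; rewrite /preimage /= uE.
by exists v; apply: hom_eq => x; rewrite lm_fun_comp vE uE.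
Qed.

(** An open surjection is universal among the maps vanishing on its kernel. *)
Lemma factor_epi A B T (p : hom A B) (t : hom A T) :
  surj_hom m p -> open_hom m p -> (forall x, fn p x = 0 -> fn t x = 0) ->
  exists u : hom B T, u \oc p = t.
Proof.
move=> srj opp kpt; have [r pr] := choice srj.
pose u y := fn t (r y).
have uE x : u (fn p x) = fn t x.
  by apply/eqP; rewrite -subr_eq0 /u -linearB kpt // linearB pr subrr.
have u_lin : linear u.
  move=> a x y; rewrite -[in LHS](pr x) -[in LHS](pr y) -linearP uE linearP.
  by rewrite -!uE !pr.
pose u' : {linear car B -> car T} := HB.pack u
  (GRing.isLinear.Build R (car B) (car T) *:%R u u_lin).
have [|v vE] := @lm_fun_full _ _ m B T u'.
  move=> V oV; apply: (lm_open_up (opp _ (lm_fun_continuous t oV))).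
    exact: (submodule_preim u' (lm_open_submodule oV)).
  by move=> _ [x Vx <-]; rewrite /preimage /= uE.
by exists v; apply: hom_eq => x; rewrite lm_fun_comp vE /= uE.
Qed.

Lemma surj_epi A B T (p : hom A B) (u v : hom B T) :
  surj_hom m p -> u \oc p = v \oc p -> u = v.
Proof.
move=> srj uv; apply: hom_eq => y; have [x <-] := srj y.
by rewrite -!lm_fun_comp uv.
Qed.

Lemma inj_mono K A T (i : hom K A) (u v : hom T K) :
  injective (fn i) -> i \oc u = i \oc v -> u = v.
Proof. by move=> inj uv; apply: hom_eq => x; apply: inj; rewrite -!lm_fun_comp uv. Qed.

Lemma im_comp0 K A B (i : hom K A) (p : hom A B) :
  p \oc i = 0 -> forall x, im_set i x -> fn p x = 0.
Proof. by move=> pi0 _ [y _ <-]; exact: comp_eq0. Qed.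

Lemma strict_Ex1 K A B (i : hom K A) (p : hom A B) :
  surj_hom m p -> strict m i p -> Ex1 i p.
Proof.
move=> srj [inj ker emb opp].
have pi0 : p \oc i = 0.
  by apply: hom_eq => x; rewrite lm_fun_comp fn0; apply/ker; exists x.
split; split=> // T t.
  move=> pt0; have [x|u uE] := factor_mono (t := t) inj emb.
    exact/ker/(comp_eq0 pt0).
  exists u; split=> // v vE; apply: (inj_mono inj); by rewrite uE vE.
move=> ti0; have [x /ker /(im_comp0 ti0) //|u uE] := factor_epi (t := t) srj opp.
exists u; split=> // v vE; apply: (surj_epi srj); by rewrite uE vE.
Qed.

(** A categorical kernel is isomorphic to the kernel submodule with the induced
topology, because that submodule is closed and thus carries an object. *)
Lemma kernel_strict K A B (i : hom K A) (p : hom A B) : is_kernel i p ->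
  [/\ injective (fn i), forall x, fn p x = 0 <-> im_set i x & embedding m i].
Proof.
move=> [pi0 ki].
have [L [j [injj imj embj]]] := sub_obj (ker_submodule m p) (ker_closed (p := p)).
have pj0 : p \oc j = 0.
  apply: hom_eq => x; rewrite lm_fun_comp fn0.
  by change (ker_set p (fn j x)); rewrite -imj; exists x.
have [u [iu _]] := ki _ _ pj0.
(* [i] and [j] have the same universal property, so [a] and [u] are inverse *)
have [a ja] : exists a : hom K L, j \oc a = i.
  by apply: (factor_mono injj embj) => y; rewrite imj; exact: comp_eq0.
have ua : u \oc a = idm K.
  have [b [_ bU]] := ki _ _ pi0.
  by rewrite -(bU (u \oc a)) ?(bU (idm K)) ?compm1 // compA iu.
have inj : injective (fn i).
  move=> x y; rewrite -!(comp_eq (m := m) ja) => /injj axy.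
  by rewrite -[x](lm_fun_id (l := m)) -[y](lm_fun_id (l := m)) -ua !lm_fun_comp axy.
split=> //.
  move=> x; split; last exact: im_comp0.
  move=> px0; have : im_set j x by rewrite imj.
  by case=> y _ <-; exists (fn u y) => //; exact: comp_eq.
move=> U oU; have [W oW WU] := embj _ (lm_fun_continuous u oU).
exists W => // x Wx; rewrite -[x](lm_fun_id (l := m)) -ua lm_fun_comp.
by apply: WU; rewrite /preimage /= (comp_eq ja).
Qed.

(** Openness of [p] uses only cokernel tests into discrete objects: the
projection of [A] onto its discrete quotient by [U + i(K)] factors through [p],
and the kernel of the factor is an open submodule contained in the image of
[U]. *)
Lemma Ex1_strict K A B (i : hom K A) (p : hom A B) :
  surj_hom m p -> Ex1 i p -> strict m i p.
Proof.
move=> srj [ki [pi0 cp]]; have [inj ker emb] := kernel_strict ki.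
split=> // U oU.
have [D [q [qs qk oD]]] := discrete_quot (opn_sum (im_submodule m i) oU).
have qi0 : q \oc i = 0.
  apply: hom_eq => x; rewrite lm_fun_comp fn0; apply/qk.
  exists (fn i x); first by exists x.
  by rewrite subrr; exact: submod0 (lm_open_submodule oU).
have [u [up _]] := cp _ _ qi0.
apply: (lm_open_up (lm_fun_continuous u oD)).
  exact/submodule_im/lm_open_submodule.
move=> y; have [x <-] := srj y.
rewrite /preimage /= (comp_eq up) => /qk [s ims Us]; exists (x - s) => //.
by rewrite raddfB /= (im_comp0 pi0 ims) subr0.
Qed.

(** Requiring the one-point type in the class makes all lifting maps surjective
([lifts_surj]). *)
Section Class.
Variable P : Type -> Prop.
Hypothesis P_unit : P unit.

Lemma lifts_surj A B (p : hom A B) : lifts m P p -> surj_hom m p.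
Proof.
move=> lft y; have [|a _ ay] := lft unit P_unit (fun _ => y).
  by move=> U _; exact: finite_finset.
by exists (a tt).
Qed.

Definition lifting_class : seq_class C :=
  fun K A B i p => Ex1 i p /\ lifts m P p.

Lemma lifting_classP K A B (i : hom K A) (p : hom A B) :
  lifting_class i p <-> strict m i p /\ lifts m P p.
Proof.
split=> -[h lft]; split=> //; have srj := lifts_surj lft.
  exact: Ex1_strict.
exact: strict_Ex1.
Qed.

Lemma lifting_epiP A B (p : hom A B) :
  admissible_epi lifting_class p <-> open_hom m p /\ lifts m P p.
Proof.
split=> [[K [i /lifting_classP [[_ _ _ opp] lft]]]//|[opp lft]].
have [K [j [injj imj embj]]] := sub_obj (ker_submodule m p) (ker_closed (p := p)).
by exists K, j; apply/lifting_classP; split=> //; split=> // x; rewrite imj.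
Qed.

(** The intrinsic form of an admissible monomorphism: a closed embedding with
complete quotient, along whose quotient map families lift. *)
Record lifting_mono K A (i : hom K A) : Prop := LiftingMono {
  lmono_inj : injective (fn i);
  lmono_embedding : embedding m i;
  lmono_closed : fam_closed (opn A) (im_set i);
  lmono_complete : fam_complete (above (opn A) (im_set i));
  lmono_lifts : lifts_mod P (opn A) (im_set i) }.

Lemma lifting_monoP K A (i : hom K A) :
  admissible_mono lifting_class i <-> lifting_mono i.
Proof.
split=> [[B [p /lifting_classP [[inj ker emb opp] lft]]]|[inj emb cl cpl lft]].
  have srj := lifts_surj lft.
  have opp' U : opn A U -> im_set i `<=` U -> opn B (fn p @` U).
    by move=> oU _; exact: opp.
  have sA := @opn_subgroup _ _ m A; have ctp := @lm_fun_continuous _ _ m A B p.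
  split=> //.
  - apply/(fam_separated_quotient srj ker sA ctp opp'); last exact: lm_separated.
    by move=> U; apply: opn_sum; exact: im_submodule.
  - by apply/(fam_complete_quotient srj ker sA ctp opp'); exact: lm_complete.
  - exact/(lifts_mod_quotient srj ker sA ctp opp').
have [B [p [srj ker opp]]] := quot_obj (im_submodule m i) cl cpl.
have opp' U : opn A U -> im_set i `<=` U -> opn B (fn p @` U).
  by move=> oU _; exact: opp.
have sA := @opn_subgroup _ _ m A; have ctp := @lm_fun_continuous _ _ m A B p.
exists B, p; apply/lifting_classP; split; first by split.
exact/(lifts_mod_quotient srj ker sA ctp opp').
Qed.

End Class.

End Lifting.

(** * Stability under isomorphism and composition *)
Section Stability.
Variables (R : nzRingType) (C : preadditive) (m : linear_model R C).
Local Notation car := (lm_car m).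
Local Notation opn A := (@lm_open R C m A).
Local Notation fn := (lm_fun m).
Implicit Types A B D K L Q : C.

Lemma above_meet A S U V :
  above (opn A) S U -> above (opn A) S V -> above (opn A) S (U `&` V).
Proof. by move=> [? SU] [? SV]; split; [exact: lm_openI | move=> x Sx; split; auto]. Qed.

Lemma double_diff (M : zmodType) (x y z u v : M) :
  (x - y - u) - (z - y - v) + (z - x) = v - u.
Proof.
rewrite [- (z - _ - _)]opprD [X in X + (z - x)]addrACA opprK opprB subrKA.
by rewrite addrAC -[z - x]opprB subrr add0r addrC.
Qed.

Lemma null_comp A B (f : hom A B) X (a : X -> car A) :
  null_family (opn A) a -> null_family (opn B) (fn f \o a).
Proof. by move=> na V oV; exact: na (lm_fun_continuous f oV). Qed.

Lemma null_add A X (a b : X -> car A) :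
  null_family (opn A) a -> null_family (opn A) b ->
  null_family (opn A) (fun x => a x + b x).
Proof.
move=> na nb U oU; have fin : finite_set ([set x | ~ U (a x)] `|` [set x | ~ U (b x)]).
  by rewrite finite_setU; split; [exact: na|exact: nb].
apply: sub_finite_set fin => x /= nab.
have [Ua|] := pselect (U (a x)); last by left.
right=> Ub; apply: nab; exact: (submodD (lm_open_submodule oU)).
Qed.

Lemma lifts_comp P A B D (g : hom B D) (f : hom A B) :
  lifts m P g -> lifts m P f -> lifts m P (g \oc f).
Proof.
move=> lg lf X PX c nc; have [b nb bc] := lg X PX c nc.
have [a na ab] := lf X PX b nb.
by exists a => // x; rewrite lm_fun_comp ab.
Qed.

Lemma lifts_cancel P A B D (g : hom B D) (f : hom A B) :
  lifts m P (g \oc f) -> lifts m P g.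
Proof.
move=> lgf X PX c nc; have [a na ac] := lgf X PX c nc.
by exists (fn f \o a); [exact: null_comp | move=> x; rewrite -ac lm_fun_comp].
Qed.

Lemma lifts_id P A : lifts m P (idm A).
Proof. by move=> X PX c nc; exists c => // x; rewrite lm_fun_id. Qed.

Lemma open_comp A B D (g : hom B D) (f : hom A B) :
  open_hom m g -> open_hom m f -> open_hom m (g \oc f).
Proof.
move=> hg hf U oU; have -> : fn (g \oc f) @` U = fn g @` (fn f @` U).
  apply/seteqP; split=> [_ [x Ux <-]|_ [_ [x Ux <-] <-]].
    by exists (fn f x); [exists x | rewrite lm_fun_comp].
  by exists x; rewrite // lm_fun_comp.
by apply: hg; exact: hf.
Qed.

Lemma open_cancel A B D (g : hom B D) (f : hom A B) :
  open_hom m (g \oc f) -> open_hom m g.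
Proof.
move=> ogf U oU; apply: (lm_open_up (ogf _ (lm_fun_continuous f oU))).
  exact/submodule_im/lm_open_submodule.
by move=> _ [x Ux <-]; exists (fn f x); rewrite ?lm_fun_comp.
Qed.

Lemma open_id A : open_hom m (idm A).
Proof.
move=> U oU; apply: (lm_open_up oU); first exact/submodule_im/lm_open_submodule.
by move=> x Ux; exists x; rewrite ?lm_fun_id.
Qed.

Section Biproduct.
Variables (A B S : C) (iA : hom A S) (iB : hom B S) (pA : hom S A)
  (pB : hom S B).
Hypothesis bip : is_biproduct iA iB pA pB.

Lemma bip_pAiA x : fn pA (fn iA x) = x.
Proof. by case: bip => h _ _ _ _; rewrite (comp_eq h) lm_fun_id. Qed.
Lemma bip_pBiB x : fn pB (fn iB x) = x.
Proof. by case: bip => _ h _ _ _; rewrite (comp_eq h) lm_fun_id. Qed.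
Lemma bip_pAiB x : fn pA (fn iB x) = 0.
Proof. by case: bip => _ _ h _ _; exact: comp_eq0. Qed.
Lemma bip_pBiA x : fn pB (fn iA x) = 0.
Proof. by case: bip => _ _ _ h _; exact: comp_eq0. Qed.
Lemma bip_sum x : fn iA (fn pA x) + fn iB (fn pB x) = x.
Proof.
case: bip => _ _ _ _ h.
by rewrite -!lm_fun_comp -lm_funD h lm_fun_id.
Qed.
Definition bipE := (bip_pAiA, bip_pBiB, bip_pAiB, bip_pBiA).

Lemma bip_ext x y : fn pA x = fn pA y -> fn pB x = fn pB y -> x = y.
Proof. by move=> hA hB; rewrite -[x]bip_sum -[y]bip_sum hA hB. Qed.

Lemma bip_open_pA : open_hom m pA.
Proof. by apply: (@open_cancel _ _ _ _ iA); case: bip => -> *; exact: open_id. Qed.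

Lemma bip_lifts_pA P : lifts m P pA.
Proof. by apply: (@lifts_cancel _ _ _ _ _ iA); case: bip => -> *; exact: lifts_id. Qed.

End Biproduct.

Lemma iso_inv A B (f : hom A B) : is_iso f ->
  exists g : hom B A, [/\ cancel (fn f) (fn g), cancel (fn g) (fn f)
    & f \oc g = idm B].
Proof.
move=> [g [gf fg]]; exists g.
by split=> // x; rewrite (comp_eq gf, comp_eq fg) lm_fun_id.
Qed.

Section Exactness.
Variable P : Type -> Prop.
Hypothesis P_unit : P unit.
Local Notation E := (lifting_class m P).
Local Notation classP := (lifting_classP m P_unit).
Local Notation monoP := (lifting_monoP m P_unit).
Local Notation epiP := (lifting_epiP m P_unit).

Lemma lifting_class_iso K A B K' A' B' (i : hom K A) (p : hom A B)
    (i' : hom K' A') (p' : hom A' B')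
    (a : hom K K') (b : hom A A') (c : hom B B') :
  is_iso a -> is_iso b -> is_iso c ->
  b \oc i = i' \oc a -> c \oc p = p' \oc b -> E i p -> E i' p'.
Proof.
move=> /iso_inv [a' [aK a'K _]] /iso_inv [b' [bK b'K bb']].
move=> /iso_inv [c' [cK c'K cc']] bi cp /classP [[inj ker emb opp] lft].
have i'a x : fn i' (fn a x) = fn b (fn i x) by rewrite -!lm_fun_comp bi.
have p'b x : fn p' (fn b x) = fn c (fn p x) by rewrite -!lm_fun_comp cp.
have i'E x : fn i' x = fn b (fn i (fn a' x)) by rewrite -i'a a'K.
have p'E : c \oc p \oc b' = p' by rewrite cp -compA bb' compm1.
apply/classP; split; last first.
  rewrite -p'E; apply: lifts_comp; last first.
    by apply: (@lifts_cancel _ _ _ _ _ b);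
      rewrite (_ : b' \oc b = idm A); [exact: lifts_id |
      apply: (lm_fun_faithful (l := m)) => x; rewrite lm_fun_comp lm_fun_id bK].
  apply: lifts_comp => //.
  by apply: (@lifts_cancel _ _ _ _ _ c'); rewrite cc'; exact: lifts_id.
split.
- by move=> x y; rewrite !i'E => /(can_inj bK) /inj /(can_inj a'K).
- move=> x; rewrite -[in fn p' x](b'K x) p'b; split.
    move=> h; have /ker [y _ iy] : fn p (fn b' x) = 0.
      by apply: (can_inj cK); rewrite h linear0.
    by exists (fn a y) => //; rewrite i'a iy b'K.
  move=> [y _ <-]; rewrite i'E bK; suff /ker -> : im_set i (fn i (fn a' y)).
    by rewrite linear0.
  by exists (fn a' y).
- move=> U oU; have [W oW WU] := emb _ (lm_fun_continuous a oU).
  exists (fn b' @^-1` W); first exact: lm_fun_continuous.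
  move=> x; rewrite /preimage /= i'E bK => Wx.
  by have := WU (fn a' x) Wx; rewrite /preimage /= a'K.
- move=> U oU.
  apply: (lm_open_up (lm_fun_continuous c' (opp _ (lm_fun_continuous b oU)))).
    exact/submodule_im/lm_open_submodule.
  move=> y [x Ux px]; exists (fn b x) => //.
  by rewrite p'b px c'K.
Qed.

(** Completeness is the statement that an extension of complete modules is
complete, applied to the extension D / A of D / B by B / A.  A coset family of
[D] above [A] is first approximated modulo [B] by a point [b], since D / B is
complete; the difference is a coset family of [B] above [A], and it has a
common point since B / A is complete.  Families are lifted by the same two
steps. *)
Lemma lifting_mono_comp A B D (g : hom B D) (f : hom A B) :
  lifting_mono m P g -> lifting_mono m P f -> lifting_mono m P (g \oc f).
Proof.
move=> [injg embg clg cplg lg] [injf embf clf cplf lf].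
have imgf (x : car A) : im_set (g \oc f) (fn g (fn f x)).
  by exists x; rewrite ?lm_fun_comp.
have gfim (x : car D) : im_set (g \oc f) x -> im_set g x.
  by move=> [y _ <-]; exists (fn f y); rewrite ?lm_fun_comp.
have above_gf W : above (opn D) (im_set g) W -> above (opn D) (im_set (g \oc f)) W.
  by move=> [oW gW]; split=> // x /gfim /gW.
have sD U : opn D U -> submodule U by exact: lm_open_submodule.
have sB U : opn B U -> submodule U by exact: lm_open_submodule.
(* The topology of [B] is induced by [D]: every open [U] above [A] contains the
   trace of an open [W] above [A]. *)
have thick U : exists W, above (opn B) (im_set f) U ->
    above (opn D) (im_set (g \oc f)) W /\ fn g @^-1` W `<=` U.
  have [[oU fU]|nU] := pselect (above (opn B) (im_set f) U); last first.
    by exists setT => /nU.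
  have [W0 oW0 W0U] := embg _ oU.
  exists [set x | exists2 s, im_set (g \oc f) s & W0 (x - s)] => _; split.
    split; first by apply: opn_sum => //; exact: im_submodule.
    by move=> s ims; exists s; rewrite // subrr; exact: submod0 (sD _ oW0).
  move=> y [_ [x _ <-]]; rewrite lm_fun_comp -linearB => /W0U Uyx.
  by rewrite -(subrK (fn f x) y); apply: (submodD (sB _ oU)) => //; apply: fU; exists x.
have [w wP] := choice thick.
split.
- by move=> x y; rewrite !lm_fun_comp => /injg /injf.
- move=> U oU; have [V oV VU] := embf _ oU; have [W oW WV] := embg _ oV.
  by exists W => // x; rewrite /preimage /= lm_fun_comp => /WV /VU.
- move=> x hx; have /clg [y _ yx] : forall U, opn D U ->
      exists2 s, im_set g s & U (x - s).
    by move=> U /hx [s /gfim ? ?]; exists s.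
  subst x; have /clf [z _ <-] : forall U, opn B U ->
      exists2 s, im_set f s & U (y - s); last exact: imgf.
  move=> U oU; have [W oW WU] := embg _ oU; have [_ [x _ <-]] := hx _ oW.
  by rewrite lm_fun_comp -linearB => /WU ?; exists (fn f x) => //; exists x.
- move=> c cc; have [|b hb] := cplg c.
    by move=> U V /above_gf aU /above_gf aV; exact: cc.
  (* The given coset of [W], translated by [- b], meets [B]: it lies in [W + B]
     because [b] is the common point of the cosets above [B]. *)
  have ex W : exists n, above (opn D) (im_set (g \oc f)) W ->
      W (c W - b - fn g n).
    have [aW|nW] := pselect (above (opn D) (im_set (g \oc f)) W); last first.
      by exists 0 => /nW.
    case: (aW) => oW gfW; have sW := sD _ oW.
    pose W' := [set x | exists2 s, im_set g s & W (x - s)].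
    have aW' : above (opn D) (im_set g) W'.
      split; first by apply: opn_sum => //; exact: im_submodule.
      by move=> s ims; exists s; rewrite // subrr; exact: submod0.
    have sW' : submodule W' by apply: sD; case: aW'.
    have WW' : W `<=` W'.
      move=> x Wx; exists 0; last by rewrite subr0.
      by exists 0; rewrite ?linear0.
    have := submod_trans sW' (cc _ _ aW (above_gf _ aW') WW')
      (submod_sym sW' (hb _ aW')).
    by move=> [_ [n _ <-] ?]; exists n.
  have [n nP] := choice ex.
  (* The points [n W] need not be monotone in [W], but they agree modulo the
     larger submodule whenever two members are nested. *)
  have key W1 W3 : above (opn D) (im_set (g \oc f)) W1 ->
      above (opn D) (im_set (g \oc f)) W3 -> W3 `<=` W1 ->
      W1 (fn g (n W3 - n W1)).
    move=> a1 a3 W31; have s1 : submodule W1 by apply: sD; case: a1.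
    have := submodD s1 (submodB s1 (nP _ a1) (W31 _ (nP _ a3))) (cc _ _ a3 a1 W31).
    by rewrite double_diff linearB.
  (* Non-nested members are compared through their intersection. *)
  have keyU U W : above (opn B) (im_set f) U ->
      above (opn D) (im_set (g \oc f)) W -> U (n (w U `&` W) - n (w U)).
    move=> aU aW; have [aw wU] := wP _ aU; apply: wU.
    by apply: key => //; exact: above_meet.
  have [|a ha] := cplf (n \o w).
    move=> U V aU aV UV; have [sU sV] : submodule U /\ submodule V.
      by case: aU => /sB ? _; case: aV => /sB.
    have [[aw _] [aw' _]] := (wP _ aU, wP _ aV).
    apply: (submod_trans sV (y := n (w U `&` w V))).
      by apply: submod_sym => //; apply: UV; exact: keyU.
    by rewrite setIC; exact: keyU.
  exists (b + fn g a) => W aW; have sW : submodule W by case: aW => /sD.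
  have aU : above (opn B) (im_set f) (fn g @^-1` W).
    case: aW => oW gfW; split; first exact: lm_fun_continuous.
    by move=> _ [x _ <-]; apply: gfW; exact: imgf.
  have [aw wU] := wP _ aU.
  have anW : W (fn g (a - n W)).
    have sU : submodule (fn g @^-1` W) by apply: sB; case: aU.
    apply: (submod_trans sU (ha _ aU)).
    apply: (submod_trans sU (y := n (w (fn g @^-1` W) `&` W))).
      by apply: submod_sym => //; exact: keyU.
    by apply: key => //; exact: above_meet.
  have := submodB sW anW (nP _ aW); congr W.
  by rewrite linearB opprB subrKA opprB addrA [fn g a + b]addrC.
- move=> X PX c nc; have [|b nb bc] := lg X PX c.
    by move=> U /above_gf; exact: nc.
  have ex x : exists e, fn g e = c x - b x.
    have [e _ ec] := bc x; exists (- e).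
    by rewrite linearN ec opprB.
  have [e eE] := choice ex.
  have [|a na ae] := lf X PX e.
    move=> U aU; have [[ow gfw] wU] := wP _ aU.
    have fin : finite_set ([set x | ~ w U (c x)] `|` [set x | ~ w U (b x)]).
      by rewrite finite_setU; split; [exact: nc|exact: nb].
    apply: sub_finite_set fin => x /= nUe.
    have [wc|] := pselect (w U (c x)); last by left.
    right=> wb; apply: nUe; apply: wU; rewrite /preimage /= eE.
    exact: (submodB (sD _ ow)).
  exists (fun x => b x + fn g (a x)); first exact/null_add/null_comp.
  move=> x; have [y _ fy] := ae x.
  have -> : b x + fn g (a x) - c x = fn g (fn f y); last exact: imgf.
  by rewrite fy linearB eE opprB addrA [fn g _ + _]addrC.
Qed.

End Exactness.

End Stability.

(** * Exactness and maximality *)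
Section ExactStructure.
Variables (R : nzRingType) (C : preadditive) (m : linear_model R C).
Local Notation car := (lm_car m).
Local Notation opn A := (@lm_open R C m A).
Local Notation fn := (lm_fun m).
Implicit Types A B D K L Q : C.

Section Exactness.
Variable P : Type -> Prop.
Hypothesis P_unit : P unit.
Local Notation E := (lifting_class m P).
Local Notation classP := (lifting_classP m P_unit).
Local Notation monoP := (lifting_monoP m P_unit).
Local Notation epiP := (lifting_epiP m P_unit).

(** The graph of [- f] has the retraction [pK], and its cokernel
[pL + f \oc pK] has the section [iL]; a split projection lifts everything. *)
Lemma graph_mono K L (f : hom K L) S (iK : hom K S) (iL : hom L S)
    (pK : hom S K) (pL : hom S L) :
  is_biproduct iK iL pK pL -> lifting_mono m P (iK - iL \oc f).
Proof.
move=> bip; have bE := bipE m bip.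
set s := iK - _; have sE x : fn s x = fn iK x - fn iL (fn f x).
  by rewrite /s fnB lm_fun_comp.
pose r := pL + f \oc pK.
have rE x : fn r x = fn pL x + fn f (fn pK x) by rewrite lm_funD lm_fun_comp.
have riL : r \oc iL = idm L.
  by apply: (hom_eq (m := m)) => x; rewrite lm_fun_comp rE !bE linear0 addr0 lm_fun_id.
have pKs x : fn pK (fn s x) = x by rewrite sE linearB /= !bE subr0.
have pLs x : fn pL (fn s x) = - fn f x by rewrite sE linearB /= !bE sub0r.
apply/monoP; exists L, r; apply/classP; split; last first.
  by apply: (@lifts_cancel _ _ _ _ _ _ _ _ iL); rewrite riL; exact: lifts_id.
split.
- exact: can_inj pKs.
- move=> x; split=> [rx0|[y _ <-]]; last by rewrite rE pKs pLs addNr.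
  exists (fn pK x) => //; apply: (bip_ext bip); first by rewrite pKs.
  by rewrite pLs; apply/esym/eqP; rewrite -addr_eq0 -rE; apply/eqP.
- move=> U oU; exists (fn pK @^-1` U); first exact: lm_fun_continuous.
  by move=> x; rewrite /preimage /= pKs.
- by apply: (@open_cancel _ _ _ _ _ _ _ iL); rewrite riL; exact: open_id.
Qed.

(** The sum of [i] and the identity of [L] has the same cokernel as [i]. *)
Lemma sum_mono K A L (i : hom K A) S (iK : hom K S) (iL : hom L S)
    (pK : hom S K) (pL : hom S L) T (jA : hom A T) (jL : hom L T)
    (qA : hom T A) (qL : hom T L) :
  is_biproduct iK iL pK pL -> is_biproduct jA jL qA qL ->
  admissible_mono E i -> lifting_mono m P (jA \oc i \oc pK + jL \oc pL).
Proof.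
move=> bS bT [B [p /classP [[inj ker emb opp] lft]]].
have [bSE bTE] := (bipE m bS, bipE m bT).
set j := _ + _.
have jE x : fn j x = fn jA (fn i (fn pK x)) + fn jL (fn pL x).
  by rewrite /j lm_funD !lm_fun_comp.
have qAj x : fn qA (fn j x) = fn i (fn pK x) by rewrite jE linearD /= !bTE addr0.
have qLj x : fn qL (fn j x) = fn pL x by rewrite jE linearD /= !bTE add0r.
apply/monoP; exists B, (p \oc qA); apply/classP; split; last first.
  by apply: lifts_comp => //; exact: bip_lifts_pA bT P.
split.
- move=> x y jxy; apply: (bip_ext bS); last by rewrite -!qLj jxy.
  by apply: inj; rewrite -!qAj jxy.
- move=> x; rewrite lm_fun_comp ker; split=> [[y _ iy]|[y _ <-]].
    exists (fn iK y + fn iL (fn qL x)) => //; apply: (bip_ext bT).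
      by rewrite qAj linearD /= !bSE addr0.
    by rewrite qLj linearD /= !bSE add0r.
  by rewrite qAj; exists (fn pK y).
- move=> U oU; have [W oW WU] := emb _ (lm_fun_continuous iK oU).
  exists (fn qA @^-1` W `&` fn qL @^-1` (fn iL @^-1` U)).
    by apply: lm_openI; do ?apply: lm_fun_continuous.
  move=> x []; rewrite /preimage /= qAj qLj => /WU Ux Ux'.
  by rewrite -[x](bip_sum bS); exact: (submodD (lm_open_submodule oU)).
- by apply: open_comp => //; exact: bip_open_pA bT.
Qed.

(** The pushout is the cokernel of (i, - f).  Its quotient by [L] is the
cokernel [p] of [i], and a family that lifts along [p] lifts along the quotient
map [c] because [p] factors as [c \oc f']. *)
Lemma lifting_pushout K A L (i : hom K A) (f : hom K L) :
  admissible_mono E i ->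
  exists Q (i' : hom L Q) (f' : hom A Q),
    is_pushout i f i' f' /\ admissible_mono E i'.
Proof.
move=> ami; have [B [p /classP [[inj ker emb opp] lft]]] := ami.
have [S [iK [iL [pK [pL bS]]]]] := biproduct_obj m K L.
have [T [jA [jL [qA [qL bT]]]]] := biproduct_obj m A L.
have [bSE bTE] := (bipE m bS, bipE m bT).
have := lifting_mono_comp (sum_mono bS bT ami) (graph_mono f bS).
set s := _ \oc _ => ms.
have sE x : fn s x = fn jA (fn i x) - fn jL (fn f x).
  rewrite /s lm_fun_comp fnB !lm_funD !lm_fun_comp !linearB /= !bSE.
  by rewrite !linear0 addr0 sub0r.
clearbody s.
have qAs x : fn qA (fn s x) = fn i x by rewrite sE linearB /= !bTE subr0.
have qLs x : fn qL (fn s x) = - fn f x by rewrite sE linearB /= !bTE sub0r.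
have [Q [q Esq]] := (monoP s).2 ms.
have [[injs kers embs opq] lftq] := (classP s q).1 Esq.
have srq := lifts_surj P_unit lftq.
have [pi0 qs0] : p \oc i = 0 /\ q \oc s = 0.
  split; apply: (hom_eq (m := m)) => x; rewrite lm_fun_comp fn0.
    by apply/ker; exists x.
  by apply/kers; exists x.
pose i' := q \oc jL; pose f' := q \oc jA.
have i'E x : fn i' x = fn q (fn jL x) by rewrite lm_fun_comp.
have f'E x : fn f' x = fn q (fn jA x) by rewrite lm_fun_comp.
exists Q, i', f'; split.
  split.
    apply: (hom_eq (m := m)) => x; rewrite !lm_fun_comp; apply/eqP.
    by rewrite -subr_eq0 -linearB -sE (comp_eq0 qs0).
  move=> X a l al; have alE x : fn a (fn i x) = fn l (fn f x).
    by rewrite -!lm_fun_comp al.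
  have [|u uE] := factor_epi (t := a \oc qA + l \oc qL) srq opq.
    move=> x /kers [y _ <-].
    by rewrite lm_funD !lm_fun_comp qAs qLs linearN alE subrr.
  have uq x : fn u (fn q x) = fn a (fn qA x) + fn l (fn qL x).
    by rewrite (comp_eq uE) lm_funD !lm_fun_comp.
  exists u; split.
    split; apply: (hom_eq (m := m)) => x; rewrite lm_fun_comp ?f'E ?i'E uq !bTE.
      by rewrite linear0 addr0.
    by rewrite linear0 add0r.
  move=> v [va vl]; apply: (surj_epi srq); rewrite uE; apply: (hom_eq (m := m)) => x.
  by rewrite -va -vl !lm_funD !lm_fun_comp -!linearD bip_sum.
have [|c cE] := factor_epi (t := p \oc qA) srq opq.
  by move=> x /kers [y _ <-]; rewrite lm_fun_comp qAs (comp_eq0 pi0).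
have cq x : fn c (fn q x) = fn p (fn qA x) by rewrite (comp_eq cE) lm_fun_comp.
have cf' : c \oc f' = p.
  by apply: (hom_eq (m := m)) => x; rewrite lm_fun_comp f'E cq bTE.
exists B, c; apply/classP; split; last first.
  by apply: (@lifts_cancel _ _ _ _ _ _ _ _ f'); rewrite cf'.
split.
- have inj0 x : fn i' x = 0 -> x = 0.
    rewrite i'E => /kers [y _ sy].
    have iy : fn i y = 0 by rewrite -qAs sy bTE.
    have y0 : y = 0 by apply: inj; rewrite iy linear0.
    by have := bTE.1.1.2 x; rewrite -sy qLs y0 linear0 oppr0.
  by move=> x y xy; apply/subr0_eq/inj0; rewrite linearB xy subrr.
- move=> z; split=> [|[l _ <-]]; last by rewrite i'E cq bTE linear0.
  have [d <-] := srq z; rewrite cq => /ker [y _ iy].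
  exists (fn qL d + fn f y) => //.
  rewrite i'E -[in RHS](subrK (fn s y) d) [in RHS]linearD (comp_eq0 qs0) addr0.
  congr (fn q _); apply: (bip_ext bT); rewrite linearB !bTE.
    by rewrite qAs iy subrr.
  by rewrite qLs opprK.
- move=> U oU; have [W oW WU] := emb _ (lm_fun_continuous f oU).
  exists (fn q @` (fn qA @^-1` W `&` fn qL @^-1` U)).
    by apply: opq; apply: lm_openI; exact: lm_fun_continuous.
  move=> l [d [Wd Ud]]; rewrite i'E => /eqP; rewrite -subr_eq0 -linearB.
  move=> /eqP /kers [y _ sy].
  have iy : fn i y = fn qA d by rewrite -qAs sy linearB !bTE subr0.
  have fy : - fn f y = fn qL d - l by rewrite -qLs sy linearB !bTE.
  rewrite (_ : l = fn qL d + fn f y); last first.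
    by rewrite -[fn f y]opprK fy opprB addrC subrK.
  apply: (submodD (lm_open_submodule oU)) => //.
  by apply: WU; rewrite /preimage /= iy.
- by apply: (@open_cancel _ _ _ _ _ _ _ f'); rewrite cf'.
Qed.

(** The pullback is the kernel of [p - f] on the biproduct; its projection to
[L] lifts a family by lifting its image in [B] along [p]. *)
Lemma lifting_pullback A B L (p : hom A B) (f : hom L B) :
  admissible_epi E p ->
  exists Q (p' : hom Q L) (f' : hom Q A),
    is_pullback p f p' f' /\ admissible_epi E p'.
Proof.
move=> /epiP [opp lft].
have [S [iA [iL [pA [pL bS]]]]] := biproduct_obj m A L.
have bSE := bipE m bS.
pose d := p \oc pA - f \oc pL.
have dE x : fn d x = fn p (fn pA x) - fn f (fn pL x).
  by rewrite fnB !lm_fun_comp.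
have [Q [j [injj imj embj]]] := sub_obj (ker_submodule m d) (ker_closed (p := d)).
have imjP x : im_set j x <-> fn p (fn pA x) = fn f (fn pL x).
  rewrite imj /ker_set /= dE; split=> [/subr0_eq //|->]; exact: subrr.
pose p' := pL \oc j; pose f' := pA \oc j.
have p'E x : fn p' x = fn pL (fn j x) by rewrite lm_fun_comp.
have f'E x : fn f' x = fn pA (fn j x) by rewrite lm_fun_comp.
have pf x : fn p (fn f' x) = fn f (fn p' x).
  by rewrite f'E p'E; apply/imjP; exists x.
have lift a l : fn p a = fn f l -> exists2 y, fn f' y = a & fn p' y = l.
  move=> al; have [|y _ jy] := (imjP (fn iA a + fn iL l)).2.
    by rewrite !linearD !bSE !linear0 addr0 add0r.
  by exists y; rewrite ?f'E ?p'E jy linearD !bSE ?addr0 ?add0r.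
exists Q, p', f'; split.
  split; first by apply: (hom_eq (m := m)) => x; rewrite !lm_fun_comp -f'E -p'E pf.
  move=> T a l al; have [x|u uE] := factor_mono (t := iA \oc a + iL \oc l) injj embj.
    apply/imjP; rewrite lm_funD !lm_fun_comp !linearD !bSE !linear0 addr0 add0r.
    by rewrite -!lm_fun_comp al.
  have jE x : fn j (fn u x) = fn iA (fn a x) + fn iL (fn l x).
    by rewrite (comp_eq uE) lm_funD !lm_fun_comp.
  exists u; split.
    split; apply: (hom_eq (m := m)) => x; rewrite !lm_fun_comp jE linearD !bSE.
      by rewrite addr0.
    by rewrite add0r.
  move=> v [va vl]; apply: (inj_mono injj); rewrite uE; apply: (hom_eq (m := m)) => x.
  by rewrite -va -vl lm_funD !lm_fun_comp bip_sum.
apply/epiP; split.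
  move=> U oU; have [W oW WU] := embj _ oU; have sW := lm_open_submodule oW.
  have o1 := lm_fun_continuous iA oW; have o2 := lm_fun_continuous iL oW.
  apply: (lm_open_up (lm_openI o2 (lm_fun_continuous f (opp _ o1)))).
    exact/submodule_im/lm_open_submodule.
  move=> l [Wl [a Wa al]]; have [y ya yl] := lift _ _ al; exists y => //.
  apply: WU; rewrite /preimage /= -[fn j y](bip_sum bS) -f'E -p'E ya yl.
  exact: (submodD sW).
move=> X PX c nc; have [a na ac] := lft X PX (fn f \o c) (null_comp f nc).
have ex x : exists y, fn f' y = a x /\ fn p' y = c x.
  by have [y ? ?] := lift _ _ (ac x); exists y.
have [b bE] := choice ex; exists b; last by move=> x; case: (bE x).
move=> U oU; have [W oW WU] := embj _ oU; have sW := lm_open_submodule oW.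
have nn := null_add (null_comp iA na) (null_comp iL nc).
apply: sub_finite_set (nn _ oW) => x /= nUb Wx; apply: nUb; apply: WU.
rewrite /preimage /= -[fn j _](bip_sum bS) -f'E -p'E.
by have [-> ->] := bE x.
Qed.

Lemma lifting_exact : is_exact_structure E.
Proof.
split.
- by split; [exact: zero_obj m | exact: biproduct_obj m].
- by move=> K A B i p [].
- by move=> *; apply: lifting_class_iso; eassumption.
- move=> A; apply/monoP.
  have imT x : im_set (idm A) x by exists x; rewrite ?lm_fun_id.
  split.
  + by move=> x y; rewrite !lm_fun_id.
  + by move=> U oU; exists U => // x; rewrite /preimage /= lm_fun_id.
  + by move=> x _; exact: imT.
  + by move=> c _; exists 0 => U [_ TU]; exact: TU.
  + move=> X PX c nc; exists (fun=> 0); last by move=> x; exact: imT.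
    move=> U oU; apply: sub_finite_set (@finite_set0 X) => x /=; apply.
    exact: submod0 (lm_open_submodule oU).
- by move=> A; apply/epiP; split; [exact: open_id | exact: lifts_id].
- by move=> A B D g f /monoP mg /monoP mf; apply/monoP; exact: lifting_mono_comp.
- move=> A B D g f /epiP [og lg] /epiP [hf lf]; apply/epiP.
  by split; [exact: open_comp | exact: lifts_comp].
- exact: lifting_pushout.
- exact: lifting_pullback.
Qed.

End Exactness.

(** The image of [p] is open because the target is discrete; the quotient by it
is an object, and the projection onto this quotient vanishes on [p], which is an
epimorphism. *)
Lemma cokernel_discrete_surj K A G (i : hom K A) (p : hom A G) :
  opn G [set 0] -> is_cokernel p i -> surj_hom m p.
Proof.
move=> oG [pi0 cok].
have oim : opn G (im_set p).
  apply: (lm_open_up oG); first exact: im_submodule.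
  by move=> _ ->; exists 0; rewrite ?linear0.
have [Q [q [_ qk _]]] := discrete_quot oim.
have qp0 : q \oc p = 0.
  by apply: (hom_eq (m := m)) => x; rewrite lm_fun_comp fn0; apply/qk; exists x.
have [|u [_ uU]] := cok _ (0 : hom A Q).
  by apply: (hom_eq (m := m)) => x; rewrite lm_fun_comp !fn0.
have q0 : q = 0.
  rewrite -(uU q) // -(uU 0) //.
  by apply: (hom_eq (m := m)) => x; rewrite lm_fun_comp !fn0.
move=> y; have [x _ xy] : im_set p y by apply/qk; rewrite q0 fn0.
by exists x.
Qed.

(** Any exact structure has pullbacks of admissible epimorphisms; pulling back
along a map from the discrete generator reduces to a discrete target. *)
Lemma exact_epi_surj (E' : seq_class C) A B (p : hom A B) :
  is_exact_structure E' -> admissible_epi E' p -> surj_hom m p.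
Proof.
move=> exE ep y; have [G [g [oG gen]]] := generator_obj m.
have [f fg] := gen _ y.
have [Q [p' [f' [[sq _] [K [i /(exact_Ex1 exE) [_ cok]]]]]]] :=
  exact_pullback exE f ep.
have [x xg] := cokernel_discrete_surj oG cok g.
by exists (fn f' x); rewrite (comp_eq sq) lm_fun_comp xg.
Qed.

(** A zero-convergent family indexed by such a type is a single element, so that
lifting becomes surjectivity. *)
Definition one_point (X : Type) : Prop := X = unit.

Lemma one_point_unit : one_point unit. Proof. by []. Qed.

Lemma surj_lifts_one_point A B (p : hom A B) :
  surj_hom m p -> lifts m one_point p.
Proof.
move=> srj X -> c _; have [x xc] := srj (c tt).
exists (fun=> x) => [U _|[]//]; exact: finite_finset.
Qed.

(** Every exact structure satisfies Ex1, and its epimorphisms are surjective. *)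
Lemma surjective_class_maximal :
  is_maximal_exact_structure (lifting_class m one_point).
Proof.
split=> [|E' exE K A B i p Eip]; first exact: lifting_exact one_point_unit.
split; first exact: exact_Ex1 exE _ _ _ _ _ Eip.
by apply/surj_lifts_one_point/(exact_epi_surj exE); exists K, i.
Qed.

End ExactStructure.

(** * An open surjection that does not lift zero-convergent families *)
Section Counterexample.
Variables (R : nzRingType) (C : preadditive) (m : linear_model R C).
Local Notation car := (lm_car m).
Local Notation opn A := (@lm_open R C m A).
Local Notation fn := (lm_fun m).
Implicit Types A B D K L Q : C.

Local Notation Seq := (nat -> R^o).
Local Notation Idx := (nat -> bool).

(** A neighborhood base of zero in the product topology on sequences of elements
of the discrete ring. *)
Definition tail n : set Seq := [set f | forall k, (k < n)%N -> f k = 0].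

Lemma tail_submodule n : submodule (tail n : set Seq).
Proof.
split=> // a u v hu hv k kn; change (a *: (u k : R^o) + v k = 0).
by rewrite hu // hv // scaler0 addr0.
Qed.

Lemma tail_anti n n' : (n <= n')%N -> tail n' `<=` tail n.
Proof. by move=> nn' f fn' k kn; apply: fn'; exact: leq_trans nn'. Qed.

Lemma countable_setU T (A B : set T) :
  countable A -> countable B -> countable (A `|` B).
Proof.
move=> cA cB.
have -> : A `|` B = \bigcup_(b in [set: bool]) if b then A else B.
  apply/seteqP; split=> [x [Ax|Bx]|x [[] _ ?]].
  - by exists true.
  - by exists false.
  - by left.
  - by right.
by apply: bigcup_countable => // -[].
Qed.

Lemma countable_range T (f : nat -> T) : countable (range f).
Proof.
have -> : range f = \bigcup_k [set f k].
  by apply/seteqP; split=> [_ [k _ <-]|_ [k _ ->]]; exists k.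
by apply: bigcup_countable => // k _; exact: countable1.
Qed.

(** Cantor's diagonal argument. *)
Lemma uncountable_Idx (J : set Idx) : countable J -> exists i, ~ J i.
Proof.
move=> /countable_injP [f finj]; apply/existsNP => JT.
pose d : Idx := fun n => `[< exists i : Idx, f i = n /\ ~~ i n >].
case dn : (d (f d)).
  have /asboolP [i [fi]] := dn.
  have -> : i = d by apply: finj => //; rewrite inE.
  by rewrite dn.
suff : d (f d) by rewrite dn.
by apply/asboolP; exists d; rewrite dn.
Qed.

Lemma tail_separated : fam_separated (range tail).
Proof.
move=> x hx; apply/funext => k.
by have : tail k.+1 x; [apply: hx; exists k.+1 | apply].
Qed.

Lemma tail_base : linear_base (range tail : set (set Seq)).
Proof.
split=> [_ [n _ <-]||_ _ [n _ <-] [n' _ <-]].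
- exact: tail_submodule.
- by exists (tail 0), 0%N.
- exists (tail (maxn n n')); first by exists (maxn n n').
  by move=> f hf; split; apply: tail_anti hf; rewrite (leq_maxl, leq_maxr).
Qed.

Lemma tail_complete : fam_complete (range tail).
Proof.
move=> c cc; exists (fun k => c (tail k.+1) k) => _ [n _ <-] k kn.
have tk j : range tail (tail j) by exists j.
have := cc _ _ (tk n) (tk k.+1) (tail_anti kn) k (ltnSn k).
move=> h; change (c (tail k.+1) k - c (tail n) k = 0).
by rewrite -[LHS]opprB [X in - X](h : c (tail n) k - c (tail k.+1) k = 0) oppr0.
Qed.

Definition finsupp : set (Idx -> Seq) := [set a | finite_set [set i | a i <> 0]].

Lemma finsupp_submodule : submodule (finsupp : set (Idx -> Seq)).
Proof.
split=> [|a u v fu fv]; rewrite /finsupp /=.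
  by apply: sub_finite_set (@finite_set0 Idx) => i /=; apply.
have fin : finite_set ([set i | u i <> 0] `|` [set i | v i <> 0]).
  by rewrite finite_setU.
apply: sub_finite_set fin => i /= nz.
have [ui|ui] := pselect (u i = 0); last by left.
right=> vi; apply: nz; change (a *: u i + v i = 0).
by rewrite ui vi scaler0 addr0.
Qed.

(** The direct sum of copies of the product, indexed by an uncountable set. *)
Definition Sparse : lmodType R := sub_lmod (Submod finsupp_submodule).
Definition entry (a : Sparse) : Idx -> Seq := val a.

Definition entry_linear : {linear Sparse -> (Idx -> Seq)} := val.

Lemma entryZD t (a b : Sparse) i : entry (t *: a + b) i = t *: entry a i + entry b i.
Proof. exact: (congr1 (@^~ i) (linearP entry_linear t a b)). Qed.

Lemma entryB (a b : Sparse) i : entry (a - b) i = entry a i - entry b i.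
Proof. exact: (congr1 (@^~ i) (linearB entry_linear a b)). Qed.

Lemma entry_finite (a : Sparse) : finite_set [set i | entry a i <> 0].
Proof. by have /asboolP := sub_lmodP a. Qed.

Lemma entry_ext (a b : Sparse) : (forall i, entry a i = entry b i) -> a = b.
Proof. by move=> ab; apply: val_inj; exact/funext. Qed.

Definition total (a : Sparse) : Seq := \sum_(i \in [set: Idx]) entry a i.

Lemma total_linear : linear total.
Proof.
move=> t a b.
pose D := [set i | entry a i <> 0] `|` [set i | entry b i <> 0].
have finD : finite_set D by rewrite finite_setU; split; exact: entry_finite.
have totalE c : [set i | entry c i <> 0] `<=` D ->
    total c = \sum_(i <- fset_set D) entry c i.
  move=> cD; rewrite -fsbig_finite //; apply/esym/fsbig_widen => // i [_ nD].
  by apply: contrapT => ci; apply: nD; exact: cD.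
rewrite !totalE //; [|by move=> i; right|by move=> i; left|].
  rewrite scaler_sumr -big_split; apply: eq_bigr => i _; exact: entryZD.
move=> i /= nz; have [ai|] := pselect (entry a i = 0); last by left.
by right=> bi; apply: nz; rewrite entryZD ai bi scaler0 addr0.
Qed.
HB.instance Definition _ := GRing.isLinear.Build R Sparse Seq *:%R total
  total_linear.

(** Letting [J] be countable rather than finite keeps the direct sum complete:
a limit with infinite support would have infinite support on a countable set.
It also forces zero-convergent sequences to be eventually zero. *)
Definition sparse_nbhs (J : set Idx) n : set Sparse :=
  [set a | (forall i, J i -> entry a i = 0) /\ forall i, tail n (entry a i)].

Definition sparse_base : set (set Sparse) :=
  [set U | exists (J : set Idx) n, countable J /\ U = sparse_nbhs J n].

Lemma sparse_nbhs_submodule J n : submodule (sparse_nbhs J n).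
Proof.
split=> [|t a b [Ja ta] [Jb tb]].
  by split=> [i _|i] //; exact: submod0 (tail_submodule n).
split=> [i Ji|i]; rewrite entryZD; first by rewrite Ja // Jb // scaler0 addr0.
by case: (tail_submodule n) => _; apply.
Qed.

Lemma sparse_nbhs_sub J J' n n' : J `<=` J' -> (n <= n')%N ->
  sparse_nbhs J' n' `<=` sparse_nbhs J n.
Proof.
by move=> JJ' nn' a [Ja ta]; split=> [i /JJ' /Ja|i] //; exact: tail_anti (ta i).
Qed.

Lemma sparse_linear_base : linear_base sparse_base.
Proof.
split=> [_ [J [n [_ ->]]]||_ _ [J [n [cJ ->]]] [J' [n' [cJ' ->]]]].
- exact: sparse_nbhs_submodule.
- by exists (sparse_nbhs set0 0), set0, 0%N.
- exists (sparse_nbhs (J `|` J') (maxn n n')).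
    by exists (J `|` J'), (maxn n n'); split=> //; exact: countable_setU.
  move=> a ha; split.
    by apply: (sparse_nbhs_sub _ _ ha); [move=> i; left | exact: leq_maxl].
  by apply: (sparse_nbhs_sub _ _ ha); [move=> i; right | exact: leq_maxr].
Qed.

Lemma sparse_separated : fam_separated sparse_base.
Proof.
move=> a ha; apply: entry_ext => i.
have [|+ _] := ha (sparse_nbhs [set i] 0); first by exists [set i], 0%N.
by apply.
Qed.

(** The limit is computed entry by entry. *)
Lemma sparse_complete : fam_complete sparse_base.
Proof.
move=> c cc; pose W := sparse_nbhs.
have cW J n J' n' : countable J -> countable J' -> J' `<=` J -> (n' <= n)%N ->
    W J' n' (c (W J n) - c (W J' n')).
  move=> cJ cJ' JJ' nn'; apply: cc; [by exists J, n|by exists J', n'|].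
  exact: sparse_nbhs_sub.
pose a : Idx -> Seq := fun i => entry (c (W [set i] 0%N)) i.
have aE J n i : countable J -> J i -> entry (c (W J n)) i = a i.
  move=> cJ Ji; have iJ : [set i] `<=` J by move=> _ ->.
  have [+ _] := cW J n [set i] 0%N cJ (countable1 i) iJ (leq0n n).
  by move=> /(_ i erefl); rewrite entryB => /subr0_eq.
(* An infinite support of [a] contains the range of an injective sequence; the
   member of the family at this countable range agrees with [a] there, while its
   support is finite. *)
have fa : finsupp a.
  apply: contrapT => /infiniteP /pcard_leP [f].
  have cR := countable_range f.
  have fin := entry_finite (c (W (range f) 0%N)).
  apply: infinite_nat; have := finite_preimage (f := f) _ fin.
  have -> : f @^-1` [set i | entry (c (W (range f) 0%N)) i <> 0] = setT.
    apply/seteqP; split=> // k _ /=.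
    have Rk : range f (f k) by exists k.
    have fS := @funS _ _ _ _ f k I.
    by rewrite aE.
  by apply=> x y _ _; apply: inj; rewrite inE.
have inT : a \in submod_pred (Submod finsupp_submodule) by exact/asboolP.
exists (SubLmod inT) => _ [J [n [cJ ->]]].
have aentry i : entry (SubLmod inT) i = a i by [].
split=> [i Ji|i]; rewrite entryB aentry; first by rewrite aE // subrr.
have cJi : countable (J `|` [set i]).
  by apply: countable_setU => //; exact: countable1.
rewrite -(aE (J `|` [set i]) n) //; last by right.
rewrite -entryB; have JJ : J `<=` J `|` [set i] by move=> j; left.
by have [_ h] := cW _ n J n cJi cJ JJ (leqnn n); exact: h.
Qed.

Definition unit_seq n : Seq := fun k => if k == n then 1 else 0.

Lemma single_finsupp i (f : Seq) :
  (fun i' => if i' == i then f else 0) \in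
    submod_pred (Submod finsupp_submodule).
Proof.
apply/asboolP; apply: sub_finite_set (finite_set1 i) => i' /=.
by case: eqP => [->|].
Qed.

Definition single i (f : Seq) : Sparse :=
  SubLmod (single_finsupp i f).

Lemma single_total i f : total (single i f) = f.
Proof.
rewrite /total -(fsbig_widen [set i] setT) //=.
  by rewrite fsbig_set1 /entry /= eqxx.
by move=> i' [_ /= ni]; rewrite /entry /=; case: eqP => // ->.
Qed.

Lemma total_tail J n a : sparse_nbhs J n a -> tail n (total a).
Proof.
move=> [_ ta]; apply: (big_ind (tail n)) => //.
  exact: submodD (tail_submodule n).
Qed.

(** The sum map is open: since [J] is countable, an element of [tail n] is the
sum of a function supported at one point outside [J].  A lift of the unit
vectors would have nonzero terms only; but on the countable union [J] of their
supports they would have to vanish eventually. *)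
Lemma open_surjective_not_lifting : exists (A B : C) (p : hom A B),
  [/\ open_hom m p, surj_hom m p & ~ lifts m (fun=> True) p].
Proof.
have [A [phi [[psi phiK psiK] oA]]] :=
  lm_object m sparse_linear_base sparse_separated sparse_complete.
have [B [eta [[eps etaK epsK] oB]]] :=
  lm_object m tail_base tail_separated tail_complete.
have psi_lin : linear psi.
  by move=> a x y; apply: (can_inj phiK); rewrite linearP !psiK.
pose psi' : {linear car A -> Sparse} := HB.pack psi
  (GRing.isLinear.Build R (car A) Sparse *:%R psi psi_lin).
have [|p pE] := @lm_fun_full _ _ m A B (eta \o (total \o psi')).
  move=> V /oB [sV [_ [n _ <-] nV]]; apply/oA; split.
    exact: (submodule_preim (eta \o (total \o psi')) sV).
  exists (sparse_nbhs set0 n); first by exists set0, n.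
  by move=> a /total_tail ta; rewrite /preimage /= phiK; exact: nV.
have pphi a : fn p (phi a) = eta (total a) by rewrite pE /= phiK.
exists A, B, p; split.
- move=> U /oA [sU [_ [J [n [cJ ->]]] JU]]; apply/oB; split.
    exact: submodule_im.
  exists (tail n); first by exists n.
  move=> f tf; have [i nJi] := uncountable_Idx cJ.
  exists (phi (single i f)); last by rewrite pphi single_total.
  apply: JU; split=> [i' Ji'|i']; rewrite /entry /=; case: eqP => // ii'.
  by rewrite ii' in Ji'.
- move=> y; exists (phi (single (fun=> true) (eps y))).
  by rewrite pphi single_total epsK.
- move=> lft; have [|a na ap] := lft nat I (eta \o unit_seq).
    move=> V /oB [sV [_ [n _ <-] nV]].
    apply: sub_finite_set (finite_II n) => k /= nVk.
    rewrite ltnNge; apply/negP => nk; apply: nVk; apply: nV => j jn.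
    by rewrite /unit_seq; case: eqP => // jk; move: jn; rewrite jk ltnNge nk.
  pose J := \bigcup_k [set i | entry (psi (a k)) i <> 0].
  have cJ : countable J.
    by apply: bigcup_countable => // k _; apply/finite_set_countable/entry_finite.
  have oJ : opn A (psi' @^-1` sparse_nbhs J 0).
    apply/oA; split.
      exact: (submodule_preim psi' (sparse_nbhs_submodule J 0)).
    by exists (sparse_nbhs J 0); [exists J, 0%N | move=> x; rewrite /preimage /= phiK].
  apply: infinite_nat; apply: sub_finite_set (na _ oJ) => k _ /= [ak _].
  have ak0 : psi (a k) = 0.
    apply: entry_ext => i; apply: contrapT => ni; apply: (ni); apply: ak.
    by exists k.
  have := ap k; rewrite -[a k]psiK ak0 /= linear0 linear0.
  move=> /(congr1 eps); rewrite -[0 in LHS](linear0 eta) !etaK => /(congr1 (@^~ k)).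
  by rewrite /unit_seq eqxx => /esym /eqP; rewrite oner_eq0.
Qed.

End Counterexample.

(** * Linear topologies and families of open subgroups *)
Section CompletionFamilies.
Variables (A : PreTopologicalZmodule.type) (O : set (set A)).
Hypothesis sO : forall U, O U -> subgroup U.

Lemma coset_subset (U V : set A) a b : U 0 -> subgroup V -> U `<=` V ->
  coset U a `<=` coset V b <-> V (a - b).
Proof.
move=> U0 sV UV; split=> [sub|Vab _ [u Uu <-]].
  have [|v Vv bv] := sub a; first by exists 0; rewrite ?addr0.
  by rewrite -bv addrC addKr.
exists (a - b + u); first by apply: (subgrpD sV) => //; exact: UV.
by rewrite addrA subrKC.
Qed.

Lemma coset_eq (U : set A) a b : subgroup U ->
  coset U a = coset U b <-> U (a - b).
Proof.
move=> sU; have U0 : U 0 by case: sU.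
split=> [ab|Uab]; first by apply/(coset_subset a b U0 sU) => //; rewrite ab.
apply/seteqP; split; apply/coset_subset => //.
by rewrite -opprB; exact: subgrpN.
Qed.

Lemma completion_ext (c d : completion O) :
  (forall U, component c U = component d U) -> c = d.
Proof.
case: c d => [c c1 c2] [d d1 d2] /= /funext cd; subst d.
by congr Completion; exact: Prop_irrelevance.
Qed.

Lemma separatedE : separated O <-> fam_separated O.
Proof.
split=> [sep x hx|sep x y xy].
  apply: sep; apply: completion_ext => -[U OU] /=.
  by apply/coset_eq; rewrite ?subr0; [exact: sO|exact: hx].
apply/subr0_eq/sep => U OU; apply/coset_eq; first exact: sO.
exact: (congr1 (fun c => component c (exist _ U OU)) xy).
Qed.

(** A point of the projective limit and a compatible coset family differ by the
choice of representatives. *)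
Lemma completeE : complete O <-> fam_complete O.
Proof.
split=> cpl.
  move=> c cc.
  pose comp (U : {U | O U}) := coset (sval U) (c (sval U)).
  have cc' U V : sval U `<=` sval V -> comp U `<=` comp V.
    move: U V => [U OU] [V OV] UV; apply/coset_subset => //=; try exact: sO.
      by case: (sO OU).
    exact: cc.
  have compP U : exists a, comp U = coset (sval U) a by exists (c (sval U)).
  have [a ac] := cpl (Completion compP cc').
  exists a => U OU; apply/coset_eq; first exact: sO.
  exact: (congr1 (fun d => component d (exist _ U OU)) ac).
move=> d.
have ex U : exists a, forall OU : O U, component d (exist _ U OU) = coset U a.
  have [OU|nOU] := pselect (O U); last by exists 0 => OU; case: (nOU OU).
  have [a da] := component_coset d (exist _ U OU); exists a => OU'.
  by rewrite (Prop_irrelevance OU' OU).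
have [c cE] := choice ex.
have [|a ha] := cpl c.
  move=> U V OU OV UV; apply/(coset_subset (c U) (c V) _ (sO OV) UV).
    by case: (sO OU).
  by rewrite -(cE U OU) -(cE V OV); exact: component_compat.
exists a; apply: completion_ext => -[U OU] /=; rewrite cE.
by apply/coset_eq; [exact: sO|exact: ha].
Qed.

End CompletionFamilies.

Section LinearTopologyTheory.
Variables (A : topologicalZmodType) (O : set (set A)).
Hypothesis O_open : forall U, O U -> open U /\ subgroup U.
Hypothesis O_base : linear_topology O.

(** Translations are continuous, so the neighborhoods of all points are known
from those of zero. *)
Lemma nbhs_coset x (N : set A) :
  nbhs x N <-> exists2 U, O U & forall y, U (y - x) -> N y.
Proof.
split=> [xN|[U OU UN]].
  have cx : {for 0, continuous (fun y : A => x + y)}.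
    apply: (@continuous_comp _ _ _ (fun y => (x, y)) (fun z : A * A => z.1 + z.2)).
      by apply: cvg_pair; [exact: cvg_cst|exact: cvg_id].
    exact: add_continuous.
  have [|U OU UN] := O_base (N := (fun y : A => x + y) @^-1` N).
    by apply: cx; rewrite addr0.
  by exists U => // y /UN; rewrite /preimage /= subrKC.
have cx : {for x, continuous (fun y : A => y - x)}.
  apply: (@continuous_comp _ _ _ (fun y => (y, x)) (fun z : A * A => z.1 - z.2)).
    by apply: cvg_pair; [exact: cvg_id|exact: cvg_cst].
  exact: sub_continuous.
have [oU [U0 _]] := O_open OU.
have : nbhs x ((fun y : A => y - x) @^-1` U).
  by apply: cx; rewrite subrr; exact: open_nbhs_nbhs.
by apply: filterS => y; exact: UN.
Qed.

Lemma open_subgroup_up U (V : set A) : O U -> subgroup V -> U `<=` V -> open V.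
Proof.
move=> OU sV UV; rewrite openE => x Vx; apply/nbhs_coset; exists U => // y Uyx.
by rewrite -(subrK x y); apply: (subgrpD sV) => //; exact: UV.
Qed.

End LinearTopologyTheory.

Section AdditiveMaps.
Variables (A B : topologicalZmodType) (OA : set (set A)) (OB : set (set B)).
Hypothesis OA_open : forall U, OA U -> open U /\ subgroup U.
Hypothesis OA_base : linear_topology OA.
Hypothesis OB_open : forall U, OB U -> open U /\ subgroup U.
Hypothesis OB_base : linear_topology OB.
Variable f : A -> B.
Hypothesis fB : zmod_morphism f.

Let f0 : f 0 = 0. Proof. by rewrite -(subrr 0) fB subrr. Qed.

Lemma linear_continuous : (forall V, OB V -> OA (f @^-1` V)) -> continuous f.
Proof.
move=> fV x N /(nbhs_coset OB_open OB_base) [V OV VN].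
apply/(nbhs_coset OA_open OA_base).
by exists (f @^-1` V) => [|y]; [exact: fV|rewrite /preimage /= fB => /VN].
Qed.

Lemma linear_open_map : (forall U, OA U -> open (f @` U)) <-> open_map f.
Proof.
split=> [fU N oN|fo U /OA_open [oU _]]; last exact: fo.
rewrite openE => _ [x Nx <-].
have : nbhs x N by apply: open_nbhs_nbhs.
move=> /(nbhs_coset OA_open OA_base) [U OU UN].
have /(nbhs_coset OB_open OB_base) [V OV VU] : nbhs 0 (f @` U).
  apply: open_nbhs_nbhs; split; first exact: fU.
  by exists 0 => //; case: (OA_open OU) => _ [].
apply/(nbhs_coset OB_open OB_base); exists V => // y Vyx.
have [|u Uu fu] := VU (y - f x); first by rewrite subr0.
exists (u + x); first by apply: UN; rewrite addrK.
by rewrite -[in LHS](opprK x) fB -[- x]sub0r fB f0 sub0r opprK fu subrK.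
Qed.

(** If [f] is closed and [U] is an open subgroup, the image of the complement of
[U] is a closed set that misses zero, and a neighborhood of zero outside it has
its preimage in [U].  Conversely, a point adherent to the image of a closed set
is in the closed image of [f], and its preimage is adherent to the set because
the topology is induced. *)
Lemma linear_closed_map : injective f ->
  closed_map f <->
  (forall U, OA U -> exists2 W, OB W & f @^-1` W `<=` U) /\
  fam_closed OB (range f).
Proof.
move=> finj; split=> [fc|[emb cl] F cF].
  have cl1 : closed (range f) by exact: fc closedT.
  split.
    move=> U OU; have [oU [U0 _]] := OA_open OU.
    have cU : closed (f @` ~` U) by apply: fc; exact: open_closedC.
    have : nbhs 0 (~` (f @` ~` U)).
      apply: open_nbhs_nbhs; split; first exact: closed_openC.
      by move=> [x nUx fx0]; apply: nUx; rewrite (finj x 0) // f0.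
    move=> /(nbhs_coset OB_open OB_base) [W OW WU]; exists W => // x Wx.
    apply: contrapT => nUx; apply: (WU (f x)); first by rewrite subr0.
    by exists x.
  move=> x hx; apply: contrapT => nfx.
  have : nbhs x (~` range f).
    by apply: open_nbhs_nbhs; split => //; exact: closed_openC.
  move=> /(nbhs_coset OB_open OB_base) [W OW Wf].
  have [s sf Wxs] := hx _ OW; apply: (Wf s) => //.
  by rewrite -opprB; apply: subgrpN => //; case: (OB_open OW).
rewrite closedE => x /= nx.
have near_f V : OB V -> exists2 z, F z & V (f z - x).
  move=> OV; apply: contrapT => nz; apply: nx.
  apply/(nbhs_coset OB_open OB_base); exists V => // y Vyx [z Fz zy].
  by apply: nz; exists z => //; rewrite zy.
have [|y _ yx] := cl x.
  move=> V OV; have [z Fz Vz] := near_f _ OV; exists (f z); first by exists z.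
  by rewrite -opprB; apply: subgrpN => //; case: (OB_open OV).
exists y => //; apply: contrapT => nFy.
have : nbhs y (~` F) by apply: open_nbhs_nbhs; split => //; exact: closed_openC.
move=> /(nbhs_coset OA_open OA_base) [U OU UF].
have [W OW WU] := emb _ OU; have [z Fz] := near_f _ OW.
by rewrite -yx -fB => /WU /UF.
Qed.

End AdditiveMaps.

(** Bundled so that the topology on the alias [base_top] is inferred from the
base. *)
Record subgroup_base (M : zmodType) := SubgroupBase {
  sb_set :> set (set M);
  sb_subgroup : forall U, sb_set U -> subgroup U;
  sb_nonempty : exists U, sb_set U;
  sb_meet : forall U V, sb_set U -> sb_set V ->
    exists2 W, sb_set W & W `<=` U `&` V }.

Section TopologyOfBase.

Definition base_top (M : zmodType) (B : subgroup_base M) : Type := M.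

Variables (M : zmodType) (B : subgroup_base M).
Local Notation T := (base_top B).

HB.instance Definition _ := GRing.Zmodule.on T.

Definition base_nbhs (x : T) : set_system T :=
  [set N | exists2 U, sb_set B U & forall y, U (y - x) -> N y].
HB.instance Definition _ := hasNbhs.Build T base_nbhs.

Lemma base_nbhs_filter (x : T) : ProperFilter (nbhs x).
Proof.
split.
  by move=> [U BU UN]; apply: (UN x); rewrite subrr; case: (sb_subgroup BU).
split.
- by have [U BU] := sb_nonempty B; exists U.
- move=> N N' [U BU UN] [U' BU' UN']; have [W BW WU] := sb_meet BU BU'.
  by exists W => // y /WU [? ?]; split; auto.
- by move=> N N' NN' [U BU UN]; exists U => // y /UN /NN'.
Qed.

Lemma base_nbhs_singleton (x : T) N : nbhs x N -> N x.
Proof.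
by move=> [U BU UN]; apply: UN; rewrite subrr; case: (sb_subgroup BU).
Qed.

Lemma base_nbhs_nbhs (x : T) N : nbhs x N -> nbhs x (nbhs^~ N).
Proof.
move=> [U BU UN]; exists U => // y Uyx; exists U => // z Uzy; apply: UN.
rewrite -(subrK y z) -addrA; apply: (subgrpD (sb_subgroup BU)) => //.
Qed.

HB.instance Definition _ := Nbhs_isNbhsTopological.Build T
  base_nbhs_filter base_nbhs_singleton base_nbhs_nbhs.

Lemma base_sub_continuous :
  continuous (fun x : T * T => x.1 - x.2).
Proof.
move=> [x y] N /= [U BU UN].
exists ([set z | U (z - x)], [set z | U (z - y)]).
  by split=> /=; exists U.
move=> [a b] /= [Ua Ub]; apply: UN.
have -> : a - b - (x - y) = (a - x) - (b - y).
  by rewrite opprD addrACA -opprD.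
exact: (subgrpB (sb_subgroup BU)).
Qed.
HB.instance Definition _ :=
  PreTopologicalNmodule_isTopologicalZmodule.Build T base_sub_continuous.

Lemma base_top_open (V : set T) : subgroup V ->
  open V <-> exists2 U, sb_set B U & U `<=` V.
Proof.
move=> sV; split=> [oV|[U BU UV]].
  have [U BU UV] : nbhs (0 : T) V.
    by apply: open_nbhs_nbhs; split => //; case: sV.
  by exists U => // u Uu; apply: UV; rewrite subr0.
rewrite openE => x Vx; exists U => // y Uyx.
by rewrite -(subrK x y); apply: (subgrpD sV) => //; exact: UV.
Qed.

(** The family [O] stands for all the open subgroups, or for the open subspaces. *)
Section Family.
Variable O : set (set T).
Hypothesis BO : sb_set B `<=` O.
Hypothesis OB : forall V, O V -> subgroup V /\ exists2 U, sb_set B U & U `<=` V.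

Lemma base_top_linear : linear_topology O.
Proof.
move=> N [U BU UN]; exists U; first exact: BO.
by move=> x Ux; apply: UN; rewrite subr0.
Qed.

Lemma base_top_separated : fam_separated B -> separated O.
Proof.
move=> sep; apply/separatedE; first by move=> U /OB [].
by move=> x hx; apply: sep => U BU; exact: (hx U (BO BU)).
Qed.

Lemma base_top_complete : fam_complete B -> complete O.
Proof.
move=> cpl; apply/completeE; first by move=> U /OB [].
move=> c cc; have [|a ha] := cpl c.
  by move=> U V BU BV UV; exact: (cc U V (BO BU) (BO BV) UV).
exists a => V OV; have [sV [U BU UV]] := OB OV.
have := subgrpD sV (UV _ (ha _ BU)) (cc _ _ (BO BU) OV UV).
by rewrite addrA subrK.
Qed.
End Family.

End TopologyOfBase.

Definition linear_subgroup_base (R : nzRingType) (M : lmodType R)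
    (B : set (set M)) (bB : linear_base B) : subgroup_base M.
Proof.
exists B; [|exact: base_nonempty bB|exact: base_meet bB].
move=> U /(base_submodule bB) sU; split; first exact: submod0.
by move=> x y; exact: submodB.
Defined.

(** * Strongly closed maps and topological quotients *)
Lemma strongly_surjective_forE (A B : PreTopologicalZmodule.type)
    (OA : set (set A)) (OB : set (set B)) (p : A -> B) :
  strongly_surjective_for OA OB p <-> lifts_along (fun=> True) OA OB p.
Proof.
split=> [h X _ c nc|h X c nc].
  by have [a na ac] := h X _ nc; exists a => // x; rewrite -ac.
by have [a na ac] := h X I c nc; exists a => //; exact/funext.
Qed.

Section StronglyClosed.
Variables (K A : topologicalZmodType) (Q : PreTopologicalZmodule.type).
Variables (OK : set (set K)) (OA : set (set A)) (OQ : set (set Q)).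
Hypothesis OK_open : forall U, OK U -> open U /\ subgroup U.
Hypothesis OK_base : linear_topology OK.
Hypothesis OA_open : forall U, OA U -> open U /\ subgroup U.
Hypothesis OA_base : linear_topology OA.
Variables (i : K -> A) (q : {additive A -> Q}).
Hypothesis iB : zmod_morphism i.
Hypothesis q_surj : forall y, exists x, q x = y.
Hypothesis q_ker : forall x, q x = 0 <-> range i x.
Hypothesis OQ_subgroup : forall V, OQ V -> subgroup V.
Hypothesis q_cont : forall V, OQ V -> OA (q @^-1` V).
Hypothesis q_open : forall U, OA U -> range i `<=` U -> OQ (q @` U).

(** Completeness of the quotient and strong surjectivity of the quotient map are
transported to conditions on the open subgroups of [A] above the image. *)
Lemma strongly_closedE :
  [/\ injective i, closed_map i, complete OQ & strongly_surjective_for OA OQ q]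
  <-> [/\ injective i, forall U, OK U -> exists2 W, OA W & i @^-1` W `<=` U,
    fam_closed OA (range i), fam_complete (above OA (range i))
    & lifts_mod (fun=> True) OA (range i)].
Proof.
have sA U : OA U -> subgroup U by move=> /OA_open [].
have cE := fam_complete_quotient q_surj q_ker sA q_cont q_open.
have lE := lifts_mod_quotient q_surj q_ker sA q_cont q_open (fun=> True).
split=> [[inj cl cpl srj]|[inj emb cl cpl lft]].
  have /(linear_closed_map OK_open OK_base OA_open OA_base iB inj) [emb clo] := cl.
  split=> //; first by apply/cE; exact/completeE.
  by apply/lE/strongly_surjective_forE.
split=> //.
- exact/(linear_closed_map OK_open OK_base OA_open OA_base iB inj).
- by apply/completeE => //; exact/cE.
- by apply/strongly_surjective_forE/lE.
Qed.

End StronglyClosed.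

Section TopologicalQuotient.
Variables (A : topologicalZmodType) (I : zmodClosed A).

Definition quot_map (x : A) : top_quot I := \pi_(top_quot I) x.

Lemma quot_map_zmod_morphism : zmod_morphism quot_map.
Proof.
have piD a b : quot_map (a + b) = quot_map a + quot_map b.
  exact: (@pi_addr _ _ _ _ _ (Quotient.quot I)).
by move=> x y; apply/eqP; rewrite eq_sym subr_eq -piD subrK.
Qed.
HB.instance Definition _ := GRing.isZmodMorphism.Build A (top_quot I) quot_map
  quot_map_zmod_morphism.

Lemma quot_surj y : exists x, quot_map x = y.
Proof. by exists (repr y); rewrite /quot_map reprK. Qed.

Lemma quot_ker x : quot_map x = 0 <-> x \in I.
Proof.
rewrite -(raddf0 quot_map) -[x in x \in I]subr0 Quotient.idealrBE.
by split=> [h|/eqP //]; exact/eqP.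
Qed.

Lemma quot_preim_im (U : set A) : subgroup U -> (forall x, x \in I -> U x) ->
  quot_map @^-1` (quot_map @` U) = U.
Proof.
move=> sU IU; apply/seteqP; split=> [x [u Uu ux]|x Ux]; last by exists x.
rewrite -(subrK u x); apply: (subgrpD sU) => //; apply/IU/quot_ker.
by rewrite raddfB /= ux subrr.
Qed.

Lemma quot_subgroup (V : set (top_quot I)) :
  subgroup V <-> subgroup (quot_map @^-1` V).
Proof.
rewrite /subgroup /preimage /= raddf0; split=> -[V0 VB]; split=> //.
  by move=> x y Vx Vy; rewrite raddfB; exact: VB.
move=> x y; have [a <-] := quot_surj x; have [b <-] := quot_surj y.
by rewrite -raddfB; exact: VB.
Qed.

Lemma quot_open_subgroup (V : set (top_quot I)) :
  open_subgroup V <-> open_subgroup (quot_map @^-1` V).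
Proof. by split=> -[oV /quot_subgroup sV]. Qed.

End TopologicalQuotient.

(** * Topological abelian groups *)
Section ModelZ.

(** A group is viewed as a module over the integers, so that open subgroups are
open submodules. *)
Definition carZ (A : topscZ) : lmodType int := zmodule (topscZ_sort A).

Lemma submodule_subgroup (M : lmodType int) (U : set M) :
  submodule U <-> subgroup U.
Proof.
split=> [sU|sU].
  by split; [exact: submod0 | move=> x y; exact: submodB].
have UMn u n : U u -> U (u *+ n).
  move=> Uu; elim: n => [|n IH]; first by case: sU.
  by rewrite mulrS; exact: subgrpD.
split=> [|n u v Uu Uv]; first by case: sU.
rewrite -[n]intz scaler_int; apply: (subgrpD sU) => //.
case: n => n; first exact: UMn.
by rewrite NegzE mulrNz; apply: (subgrpN sU); exact: UMn.
Qed.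

Lemma open_subgroupP (A : topscZ) (U : set A) : open_subgroup U -> open U /\ subgroup U.
Proof. by []. Qed.

Definition homZ_lin (A B : topscZ) (f : homZ A B) : carZ A -> carZ B := f.

Lemma homZ_lin_linear (A B : topscZ) (f : homZ A B) : linear (homZ_lin f).
Proof. by move=> n x y; rewrite /homZ_lin raddfD /= !scalezrE raddfMz. Qed.
HB.instance Definition _ (A B : topscZ) (f : homZ A B) :=
  GRing.isLinear.Build int (carZ A) (carZ B) *:%R (homZ_lin f) (homZ_lin_linear f).

Lemma objectZ (M : lmodType int) (B : set (set M)) :
    linear_base B -> fam_separated B -> fam_complete B ->
    exists (A : topscZ) (phi : {linear M -> carZ A}), bijective phi /\
      forall W : set (carZ A), open_subgroup W <->
        submodule W /\ exists2 U, B U & U `<=` phi @^-1` W.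
Proof.
move=> bB sepB cplB; pose sb := linear_subgroup_base bB.
have BO : sb_set sb `<=` @open_subgroup (base_top sb).
  move=> U BU; have sU : subgroup U by exact: sb_subgroup BU.
  by split=> //; apply/(base_top_open sU); exists U.
have OB (V : set (base_top sb)) : open_subgroup V ->
    subgroup V /\ exists2 U, sb_set sb U & U `<=` V.
  by move=> [oV sV]; split=> //; exact/base_top_open.
pose A := TopscZ (base_top_linear BO) (base_top_separated BO OB sepB)
  (base_top_complete BO OB cplB).
have lin : linear (fun x : M => x : carZ A).
  (* Both integer actions are iterated addition. *)
  by move=> n x y; rewrite -[in LHS](intz n) scaler_int.
pose phi : {linear M -> carZ A} := HB.pack (fun x : M => x : carZ A)
  (GRing.isLinear.Build int M (carZ A) *:%R _ lin).
exists A, phi; split; first by exists id.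
move=> W; split=> [[oW sW]|[/submodule_subgroup sW [U BU UW]]].
  split; first exact/submodule_subgroup.
  exact/(base_top_open sW).
by split=> //; apply/(base_top_open sW); exists U.
Qed.

Lemma openZ_up (A : topscZ) (U V : set A) :
  open_subgroup U -> subgroup V -> U `<=` V -> open_subgroup V.
Proof.
move=> oU sV UV; split=> //.
exact: (open_subgroup_up (@open_subgroupP A) (@topscZ_linear A) oU).
Qed.

Lemma setT_open_subgroup (A : topscZ) : @open_subgroup A setT.
Proof. by split; first exact: openT. Qed.

Lemma setI_open_subgroup (A : topscZ) (U V : set A) :
  open_subgroup U -> open_subgroup V -> open_subgroup (U `&` V).
Proof.
move=> [oU sU] [oV sV]; split; first exact: openI.
split; first by case: sU; case: sV.
by move=> x y [Ux Vx] [Uy Vy]; split; exact: subgrpB.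
Qed.

Lemma preim_open_subgroup (A B : topscZ) (f : homZ A B) (V : set B) :
  open_subgroup V -> open_subgroup (f @^-1` V).
Proof.
move=> [oV sV]; split.
  by move/continuousP: (@homZ_continuous _ _ f); apply.
split; first by rewrite /preimage /= raddf0; case: sV.
by move=> x y Vx Vy; rewrite /preimage /= raddfB; exact: subgrpB.
Qed.

Lemma fullZ (A B : topscZ) (h : {linear carZ A -> carZ B}) :
  (forall V : set B, open_subgroup V -> open_subgroup (h @^-1` V : set A)) ->
  exists f : homZ A B, homZ_lin f =1 h.
Proof.
move=> hV; have hB : zmod_morphism (h : A -> B) by move=> x y; exact: (raddfB h x y).
have hc : continuous (h : A -> B).
  apply: (linear_continuous (@open_subgroupP A) (@topscZ_linear A)
    (@open_subgroupP B) (@topscZ_linear B) hB) => V oV; exact: hV.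
have hP : (h : A -> B) \in @homZ_pred A B by exact/asboolP.
by exists (HomZ hP).
Qed.

Definition modelZ : linear_model int TopscZ_cat.
Proof.
refine (@LinearModel int TopscZ_cat carZ
  (fun A => @open_subgroup (topscZ_sort A))
  (fun A B f => homZ_lin f) _ _ _ _ _ _ _ _ _ _ _ _ objectZ).
- by move=> A U [_ sU]; exact/(submodule_subgroup (U : set (carZ A))).
- exact: setT_open_subgroup.
- exact: setI_open_subgroup.
- by move=> A U V oU /submodule_subgroup; exact: openZ_up.
- by move=> A; apply/separatedE; [move=> U [] | exact: topscZ_separated].
- by move=> A; apply/completeE; [move=> U [] | exact: topscZ_complete].
- by move=> A B f V; exact: preim_open_subgroup.
- by move=> A B f g fg; apply/val_inj/funext.
- exact: fullZ.
- by [].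
- by [].
- by [].
Defined.

Lemma open_mapZ (A B : topscZ) (p : homZ A B) :
  open_map p <-> open_hom modelZ (p : @hom TopscZ_cat A B).
Proof.
rewrite -(linear_open_map (@open_subgroupP A) (@topscZ_linear A)
  (@open_subgroupP B) (@topscZ_linear B) (@homZ_zmod_morphism _ _ p)).
split=> h U oU; last by case: (h U oU).
split; first exact: h.
have [_ sU] := oU.
by have /submodule_subgroup := submodule_im (homZ_lin p)
  ((submodule_subgroup (U : set (carZ A))).2 sU).
Qed.

Lemma strongly_surjectiveZE (A B : topscZ) (p : homZ A B) :
  strongly_surjectiveZ p <->
  lifts modelZ (fun=> True) (p : @hom TopscZ_cat A B).
Proof. exact: strongly_surjective_forE. Qed.

Lemma strongly_closedZE (K A : topscZ) (i : homZ K A) :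
  strongly_closedZ i <->
  lifting_mono modelZ (fun=> True) (i : @hom TopscZ_cat K A).
Proof.
have qS := @quot_surj A (imageZ i).
have qK x : quot_map (imageZ i) x = 0 <-> range i x.
  rewrite quot_ker; split=> [/asboolP [y <-]|[y _ <-]]; first by exists y.
  by apply/asboolP; exists y.
have qO V : open_subgroup (V : set (cokerZ i)) <->
    open_subgroup (quot_map (imageZ i) @^-1` V).
  exact: quot_open_subgroup.
apply: (iff_trans (strongly_closedE (@open_subgroupP K) (@topscZ_linear K)
  (@open_subgroupP A) (@topscZ_linear A) (@homZ_zmod_morphism _ _ i)
  qS qK _ _ _)).
- by move=> V [].
- by move=> V /qO.
- move=> U oU iU; apply/qO; rewrite quot_preim_im //; first by case: oU.
  by move=> x /asboolP [y <-]; apply: iU; exists y.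
split=> [[h1 h2 h3 h4 h5]|[h1 h2 h3 h4 h5]]; split=> //.
Qed.

End ModelZ.

(** * Topological vector spaces *)
Section ModelK.
Variable k : fieldType.

Definition carK (A : topscK k) : lmodType k := tv_sort (topscK_sort A).
Definition openK (A : topscK k) : set (set (carK A)) := open_subspace (topscK_sort A).

Lemma openKP (A : topscK k) (U : set A) : openK U -> open U /\ subgroup U.
Proof.
move=> [oU sU]; split=> //; split; first exact: (submod0 (U := U : set (carK A))).
move=> x y; exact: (submodB (U := U : set (carK A))).
Qed.

Lemma openK_up (A : topscK k) (U V : set (carK A)) :
  openK U -> submodule V -> U `<=` V -> openK V.
Proof.
move=> oU sV UV; split=> //.
apply: (open_subgroup_up (@openKP A) (@topscK_linear _ A) oU) => //.
split; first exact: submod0.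
by move=> x y; exact: submodB.
Qed.

Lemma preim_openK (A B : topscK k) (f : homK A B) (V : set (carK B)) :
  openK V -> openK (f @^-1` V : set (carK A)).
Proof.
move=> [oV sV]; split.
  by move/continuousP: (@homK_continuous _ _ _ f); apply.
exact: (submodule_preim (f : {linear carK A -> carK B})).
Qed.

Lemma fullK (A B : topscK k) (h : {linear carK A -> carK B}) :
  (forall V, openK V -> openK (h @^-1` V)) ->
  exists f : homK A B, (f : {linear carK A -> carK B}) =1 h.
Proof.
move=> hV; have hB : zmod_morphism (h : A -> B) by move=> x y; exact: (raddfB h x y).
have hc : continuous (h : A -> B).
  apply: (linear_continuous (@openKP A) (@topscK_linear _ A)
    (@openKP B) (@topscK_linear _ B) hB) => V oV; exact: hV.
have hL : linear (h : A -> B) by exact: linearP.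
have hP : (h : A -> B) \in @homK_pred k A B by exact/asboolP.
by exists (HomK hP).
Qed.

Lemma objectK (M : lmodType k) (B : set (set M)) :
    linear_base B -> fam_separated B -> fam_complete B ->
    exists (A : topscK k) (phi : {linear M -> carK A}), bijective phi /\
      forall W : set (carK A), openK W <->
        submodule W /\ exists2 U, B U & U `<=` phi @^-1` W.
Proof.
move=> bB sepB cplB; pose sb := linear_subgroup_base bB.
pose T : topologicalZmodType := base_top sb.
pose O : set (set T) := [set V : set T | open V /\ submodule (V : set M)].
have sg (V : set M) : submodule V -> subgroup (V : set T).
  move=> sV; split; first exact: (submod0 sV).
  by move=> x y; exact: (submodB sV).
have BO : sb_set sb `<=` O.
  move=> U BU; have sU : submodule (U : set M) by exact: base_submodule bB _ BU.
  by split=> //; apply/(base_top_open (sg _ sU)); exists U.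
have OB (V : set T) : O V -> subgroup V /\ exists2 U, sb_set sb U & U `<=` V.
  by move=> [oV sV]; split; [exact: sg | apply/(base_top_open (sg _ sV))].
have Oopen V : O V -> open V /\ subgroup V.
  by move=> OV; split; [case: OV|case: (OB _ OV)].
have scale_cont (a : k) : continuous ((fun x : M => a *: x) : T -> T).
  have lin := base_top_linear BO.
  apply: (linear_continuous Oopen lin Oopen lin).
    by move=> x y; exact: (scalerBr a (x : M) y).
  move=> V OV; have [oV sV] := OV.
  have sP : submodule ((fun x : M => a *: x) @^-1` V).
    split; first by rewrite /preimage /= scaler0; exact: (submod0 sV).
    move=> b u v Vu Vv; rewrite /preimage /= scalerDr scalerA mulrC -scalerA.
    by case: sV => _; apply.
  have [_ [U BU UV]] := OB _ OV.
  split=> //; apply/(base_top_open (sg _ sP)); exists U => // u Uu.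
  by apply: UV; apply: submodZ => //; exact: base_submodule bB _ BU.
pose V0 := @TopVect k T (fun a (x : M) => a *: x) (@scalerA k M) (@scale1r k M)
  (@scalerDr k M) (fun v a b => @scalerDl k M v a b) scale_cont.
pose A := @TopscK k V0 (base_top_linear BO) (base_top_separated BO OB sepB)
  (base_top_complete BO OB cplB).
have lin : linear (fun x : M => x : carK A) by [].
pose phi : {linear M -> carK A} := HB.pack (fun x : M => x : carK A)
  (GRing.isLinear.Build k M (carK A) *:%R _ lin).
exists A, phi; split; first by exists id.
move=> W; split=> [[oW sW]|[sW [U BU UW]]].
  by split=> //; exact/(base_top_open (sg _ sW)).
by split=> //; apply/(base_top_open (sg _ sW)); exists U.
Qed.

Definition modelK : linear_model k (TopscK_cat k).
Proof.
refine (@LinearModel k (TopscK_cat k) carK openK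
  (fun A B f => (f : homK A B) : {linear carK A -> carK B})
  _ _ _ _ _ _ _ _ _ _ _ _ objectK).
- by move=> A U [].
- by move=> A; split; first exact: openT.
- by move=> A U V [oU sU] [oV sV]; split; [exact: openI|exact: submoduleI].
- exact: openK_up.
- by move=> A; apply/separatedE; [by move=> U /(@openKP A) [] | exact: topscK_separated].
- by move=> A; apply/completeE; [by move=> U /(@openKP A) [] | exact: topscK_complete].
- by move=> A B f V; exact: preim_openK.
- by move=> A B f g fg; apply/val_inj/funext.
- exact: fullK.
- by [].
- by [].
- by [].
Defined.

Lemma open_mapK (A B : topscK k) (p : homK A B) :
  open_map p <-> open_hom modelK (p : @hom (TopscK_cat k) A B).
Proof.
have pB : zmod_morphism p by exact: raddfB.
rewrite -(linear_open_map (@openKP A) (@topscK_linear _ A)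
  (@openKP B) (@topscK_linear _ B) pB).
split=> h U oU; last by case: (h U oU).
split; first exact: h.
have [_ sU] := oU; exact: (submodule_im (p : {linear carK A -> carK B})).
Qed.

Lemma strongly_surjectiveKE (A B : topscK k) (p : homK A B) :
  strongly_surjectiveK p <->
  lifts modelK (fun=> True) (p : @hom (TopscK_cat k) A B).
Proof. exact: strongly_surjective_forE. Qed.

Lemma strongly_closedKE (K A : topscK k) (i : homK K A) :
  strongly_closedK i <->
  lifting_mono modelK (fun=> True) (i : @hom (TopscK_cat k) K A).
Proof.
have iB : zmod_morphism i by exact: raddfB.
pose q : A -> cokerK i := quot_map (imageK i).
have qB : zmod_morphism q by exact: quot_map_zmod_morphism.
pose q' : {additive A -> cokerK i} := HB.pack q
  (GRing.isZmodMorphism.Build A (cokerK i) q qB).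
have qS y : exists x, q' x = y by exact: (@quot_surj A (imageK i)).
have qK x : q' x = 0 <-> range i x.
  apply: (iff_trans (@quot_ker A (imageK i) x)).
  split=> [/asboolP [y <-]|[y _ <-]]; first by exists y.
  by apply/asboolP; exists y.
have qZ a x : q (a *: x) = a *: q x by exact: lquot_pi_scale.
have qsub (V : set (cokerK i)) : subspace V <-> subspace (q @^-1` V).
  have q0 : q 0 = 0 by exact: (raddf0 q').
  have qD x y : q (x + y) = q x + q y by exact: (raddfD q').
  rewrite /subspace /preimage /= q0; split=> -[V0 VB]; split=> //.
    by move=> a x y Vx Vy; rewrite qD qZ; exact: VB.
  move=> a x y; have [u <-] := qS x; have [v <-] := qS y.
  move=> Vu Vv; rewrite -[X in _ + X]/(q v) -[q' u]/(q u) -qZ -qD; exact: VB.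
have qO V : open_subspace (cokerK i) V <-> openK (q @^-1` V).
  by split=> -[oV /qsub sV].
apply: (iff_trans (strongly_closedE (@openKP K) (@topscK_linear _ K)
  (@openKP A) (@topscK_linear _ A) iB qS qK _ _ _)).
- move=> V [_ sV]; split; first exact: (submod0 sV).
  by move=> x y; exact: (submodB sV).
- by move=> V /qO.
- move=> U oU iU; apply/qO; have [_ sU] := openKP oU.
  rewrite (_ : q @^-1` _ = U) //; apply: quot_preim_im => //.
  by move=> x /asboolP [y <-]; apply: iU; exists y.
by split=> [[h1 h2 h3 h4 h5]|[h1 h2 h3 h4 h5]].
Qed.

End ModelK.

(** * Comparison of the two structures *)
Section Conclusion.
Variables (R : nzRingType) (C : preadditive) (m : linear_model R C).

Lemma lifting_maximal_proper :
  is_maximal_exact_structure (lifting_class m one_point) /\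
  seq_proper (lifting_class m (fun=> True)) (lifting_class m one_point).
Proof.
split; first exact: surjective_class_maximal.
split=> [K A B i p [ex lft]|].
  by split=> //; apply/surj_lifts_one_point/(lifts_surj I lft).
have [A [B [p [opp srj nlft]]]] := open_surjective_not_lifting m.
have [K [i Eip]] := (lifting_epiP m one_point_unit p).2 (conj opp (surj_lifts_one_point srj)).
by exists K, A, B, i, p; split=> // -[].
Qed.

End Conclusion.

Theorem theorem11p5 (k : fieldType) :
  (exists E : seq_class TopscZ_cat,
    [/\ is_exact_structure E,
      forall (K A C : topscZ) (i : homZ K A) (p : homZ A C),
        E K A C i p <->
        @Ex1 TopscZ_cat K A C i p /\ strongly_surjectiveZ p,
      forall (K A : topscZ) (i : homZ K A),
        admissible_mono E i <-> strongly_closedZ i,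
      forall (A C : topscZ) (p : homZ A C),
        admissible_epi E p <-> open_map p /\ strongly_surjectiveZ p
    & exists Emax : seq_class TopscZ_cat,
        is_maximal_exact_structure Emax /\ seq_proper E Emax]) /\
  (exists E : seq_class (TopscK_cat k),
    [/\ is_exact_structure E,
      forall (K V C : topscK k) (i : homK K V) (p : homK V C),
        E K V C i p <->
        @Ex1 (TopscK_cat k) K V C i p /\ strongly_surjectiveK p,
      forall (K V : topscK k) (i : homK K V),
        admissible_mono E i <-> strongly_closedK i,
      forall (V C : topscK k) (p : homK V C),
        admissible_epi E p <-> open_map p /\ strongly_surjectiveK p
    & exists Emax : seq_class (TopscK_cat k),
        is_maximal_exact_structure Emax /\ seq_proper E Emax]).
Proof.
split.
  exists (lifting_class modelZ (fun=> True)); split.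
  - exact: (lifting_exact modelZ I).
  - by move=> K A C i p; rewrite strongly_surjectiveZE.
  - by move=> K A i; rewrite strongly_closedZE; exact: (lifting_monoP modelZ I).
  - move=> A C p; rewrite open_mapZ strongly_surjectiveZE.
    exact: (lifting_epiP modelZ I).
  - exists (lifting_class modelZ one_point).
    exact: lifting_maximal_proper.
exists (lifting_class (modelK k) (fun=> True)); split.
- exact: (lifting_exact (modelK k) I).
- by move=> K A C i p; rewrite strongly_surjectiveKE.
- by move=> K A i; rewrite strongly_closedKE; exact: (lifting_monoP (modelK k) I).
- move=> A C p; rewrite open_mapK strongly_surjectiveKE.
  exact: (lifting_epiP (modelK k) I).
- exists (lifting_class (modelK k) one_point).
  exact: lifting_maximal_proper.
Qed.
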